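(* There are parametric Lipschitz manifolds that are not Lipschitz submanifolds. That is, there exist positive integers $k,N$ and a subset $M\subset\mathbb{R}^N$ such that $M$ is a $k$-dimensional parametric Lipschitz manifold, but $M$ is not a Lipschitz submanifold of $\mathbb{R}^N$ (of any dimension).
   Context: A map $f\colon X\to Y$ between subsets $X\subset\mathbb{R}^n$, $Y\subset\mathbb{R}^m$ is Lipschitz if there is $\lambda>0$ with $\|f(x_1)-f(x_2)\|\le\lambda\|x_1-x_2\|$ for all $x_1,x_2\in X$; it is bi-Lipschitz if it is Lipschitz and has an inverse mapping that is Lipschitz. A subset $M\subset\mathbb{R}^N$ is a $k$-dimensional Lipschitz submanifold if for every $x_0\in M$ there exist an open set $U\subset\mathbb{R}^N$ with $x_0\in U$ and a bi-Lipschitz mapping $\varphi\colon U\to\varphi(U)\subset\mathbb{R}^N$ such that $\varphi(M\cap U)=\{(x_1,\dots,x_N)\in\varphi(U);\ x_{k+1}=\dots=x_N=0\}$ and $\varphi(x_0)=0$. A subset $M\subset\mathbb{R}^N$ is a $k$-dimensional parametric Lipschitz manifold if for every $x_0\in M$ there exist an open neighborhood $U\subset\mathbb{R}^N$ of $x_0$, an open set $W\subset\mathbb{R}^k$ and a bi-Lipschitz mapping $\varphi\colon W\to M\cap U$ (so $\varphi$ is a bijection onto $M\cap U$). *)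

(* Defs.v *)
From HB Require Import structures.
From mathcomp Require Import all_boot all_order all_algebra.
From mathcomp Require Import all_classical all_reals all_analysis.
Set Implicit Arguments.
Unset Strict Implicit.
Unset Printing Implicit Defensive.
Import Order.TTheory GRing.Theory Num.Theory.
Import numFieldNormedType.Exports.
Local Open Scope classical_set_scope.
Local Open Scope ring_scope.

(* The library norm [`|x|] on row vectors is the max norm, hence a separate
   Euclidean norm; both induce the library topology on ['rV[R]_n]. *)
Definition enorm (R : realType) (n : nat) (x : 'rV[R]_n) : R :=
  Num.sqrt (\sum_(i < n) x 0 i ^+ 2).

Definition is_lipschitz (R : realType) (n m : nat) (X : set 'rV[R]_n)
    (f : 'rV[R]_n -> 'rV[R]_m) : Prop :=
  exists lambda : R, 0 < lambda /\
    forall x1 x2, X x1 -> X x2 ->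
      enorm (f x1 - f x2) <= lambda * enorm (x1 - x2).

(* A map X -> Y is a total function sending X into Y; its values outside X are
   irrelevant. *)
Definition is_bilipschitz (R : realType) (n m : nat) (X : set 'rV[R]_n)
    (Y : set 'rV[R]_m) (f : 'rV[R]_n -> 'rV[R]_m) : Prop :=
  [/\ set_fun X Y f,
      is_lipschitz X f &
      exists g : 'rV[R]_m -> 'rV[R]_n,
        [/\ set_fun Y X g, {in X, cancel f g}, {in Y, cancel g f} &
            is_lipschitz Y g]].

(* Coordinates are numbered from 0, so x_{k+1}, ..., x_N are those of index
   i >= k. *)
Definition lipschitz_submanifold (R : realType) (k N : nat)
    (M : set 'rV[R]_N) : Prop :=
  forall x0, M x0 ->
    exists (U : set 'rV[R]_N) (phi : 'rV[R]_N -> 'rV[R]_N),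
      [/\ open U, U x0,
          is_bilipschitz U (phi @` U) phi,
          phi @` (M `&` U) =
            [set y | (phi @` U) y /\
                     forall i : 'I_N, (k <= i)%N -> y 0 i = 0] &
          phi x0 = 0].

Definition parametric_lipschitz_manifold (R : realType) (k N : nat)
    (M : set 'rV[R]_N) : Prop :=
  forall x0, M x0 ->
    exists (U : set 'rV[R]_N) (W : set 'rV[R]_k)
           (phi : 'rV[R]_k -> 'rV[R]_N),
      [/\ open U, U x0, open W & is_bilipschitz W (M `&` U) phi].

(* Main.v *)
Require Import Defs.
From mathcomp Require Import all_boot all_order all_algebra.
From mathcomp Require Import all_classical all_reals all_analysis.
From mathcomp Require Import complex.
From mathcomp Require Import ring lra.
Set Implicit Arguments.
Unset Strict Implicit.
Unset Printing Implicit Defensive.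
Import Order.TTheory GRing.Theory Num.Theory.
Import numFieldNormedType.Exports.
Import Normc.
Local Open Scope classical_set_scope.
Local Open Scope ring_scope.
Local Open Scope complex_scope.

(** The example is the cone in C^2 = R^4 over a trefoil knot, parametrized by
    t |-> (t^3/|t|^2, t^2/|t|) for t in C = R^2, which is bi-Lipschitz.

    Suppose a bi-Lipschitz chart flattens the cone to R^l near the vertex.
    Invariance of domain, which for bi-Lipschitz maps follows from Kuhn's cubical
    Sperner lemma, rules out l <> 2 and shows that for l = 2 the chart covers a
    full neighbourhood. Off the cone, the cubic
    X^3 - 3 w|w| X + 2 z|z|^2 in X has three distinct roots, hence defines a
    three-sheeted covering. The complement of R^2 in a ball of R^4 is a union of
    three convex sets overlapping cyclically, so its coverings are determined by
    one permutation of the sheets. A permutation of three letters either fixes a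
    letter or is a 3-cycle; hence near the vertex there is either a continuous
    root of the cubic or a continuous square root of its discriminant. The first
    is impossible on the circle {w = 0, |z| = d}, where the cubic is
    X^3 = -2 z d^2, and the second on the circle {z = 0, |w| = d}, where the
    discriminant is a multiple of w^3. *)

(** The homeomorphism (z, w) |-> (q, p) = (z|z|^2, w|w|) of C^2 turns the parametrization into t |->
    (t^3, t^2). So the cone is the preimage of the cusp p^3 = q^2, whose link is the trefoil, and
    the moduli make it homogeneous, hence bi-Lipschitz to the plane. The obstruction is the knot
    group: the trefoil group maps onto the symmetric group S_3, realized here by the monodromy of a
    cubic with discriminant 108 (p^3 - q^2), whereas the complement of a flat plane has cyclic
    fundamental group. A cyclic subgroup of S_3 fixes a letter or lies in A_3. The two test circles
    act by a 3-cycle and by a transposition, and each excludes one alternative. The definition of a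
    chart does not ask its image to be open, so invariance of domain is needed even before the
    complement of the plane can be examined. Covering theory is replaced by estimates: compactness
    bounds the discriminant below, this bounds the distance between roots below, and continuation
    means passing to the nearest root. *)

(** * Cup products of coboundaries mod 2 on a cubical grid *)

Lemma F2_addrr (x : 'F_2) : x + x = 0.
Proof. by rewrite addrr_pchar2 // pchar_Fp. Qed.

Lemma F2_oppr (x : 'F_2) : - x = x.
Proof. by rewrite oppr_pchar2 // pchar_Fp. Qed.

Lemma F2_addr_eq0 (x y : 'F_2) : x + y = 0 -> x = y.
Proof. by move/eqP; rewrite addr_eq0 F2_oppr => /eqP. Qed.

Lemma remC (T : eqType) (a b : T) (S : seq T) :
  uniq S -> rem a (rem b S) = rem b (rem a S).
Proof.
move=> uS; rewrite !rem_filter ?filter_uniq // -!filter_predI.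
by apply: eq_filter => x /=; rewrite andbC.
Qed.

(** Each unordered pair is counted twice, once in each order. *)
Lemma sum_sym_rem (T : eqType) (S : seq T) (F : T -> T -> 'F_2) :
  uniq S -> (forall a b, F a b = F b a) ->
  \sum_(a <- S) \sum_(b <- rem a S) F a b = 0.
Proof.
move=> uS Fsym.
rewrite (eq_big_seq (fun a => \sum_(b <- S | b != a) F a b)); last first.
  by move=> a aS; rewrite rem_filter // big_filter; apply: eq_bigl.
elim: S uS => [|x S IH] /=; first by rewrite big_nil.
case/andP => xS uS; rewrite big_cons big_cons eqxx /=.
under [X in _ + X]eq_bigr => a _ do rewrite big_cons.
have -> : \sum_(a <- S) (if x != a then F a x + \sum_(b <- S | b != a) F a b
    else \sum_(b <- S | b != a) F a b) =
    \sum_(a <- S) (F a x + \sum_(b <- S | b != a) F a b).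
  apply: eq_big_seq => a aS; case: eqP => // xa.
  by move: xS; rewrite xa aS.
rewrite big_split /= IH // addr0.
have -> : \sum_(j <- S | j != x) F x j = \sum_(j <- S) F j x.
  rewrite big_seq_cond [RHS]big_seq_cond; apply: eq_big => [j|j _]; last exact: Fsym.
  by case jS: (j \in S) => //=; case: eqP => // jx; move: xS; rewrite -jx jS.
exact: F2_addrr.
Qed.

Definition upd (x : nat -> nat) (d i : nat) : nat -> nat :=
  fun k => if k == d then i else x k.

Definition incr (x : nat -> nat) (d : nat) : nat -> nat := upd x d (x d).+1.

Lemma incrE x d k : incr x d k = ((k == d) + x k)%N.
Proof. by rewrite /incr /upd; case: eqP => [->|]. Qed.

Lemma incrC x d e : incr (incr x d) e = incr (incr x e) d.
Proof. by apply/funext => k; rewrite !incrE addnCA. Qed.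

(* The cup product of the coboundaries of the functions in [s], evaluated on
   the cube with lowest vertex [q] and directions [S]. *)
Fixpoint cup (s : seq ((nat -> nat) -> 'F_2)) (q : nat -> nat) (S : seq nat)
    : 'F_2 :=
  if s is f :: s' then
    \sum_(d <- S) (f (incr q d) - f q) * cup s' (incr q d) (rem d S)
  else 1.


(** A product of coboundaries is a cocycle: its values on the faces of a cube of one dimension more
    cancel mod 2. *)
Lemma cup_closed s q S : uniq S -> size S = (size s).+1 ->
  \sum_(d <- S) cup s (incr q d) (rem d S) = \sum_(d <- S) cup s q (rem d S).
Proof.
elim: s q S => [|f s IH] q S uS sS //=.
have sz d : d \in S -> size (rem d S) = (size s).+1.
  by move=> dS; rewrite size_rem // sS.
apply: F2_addr_eq0.
(* The induction hypothesis moves the base point of [cup s] in the subtracted terms to the argument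
   of [f]; the summand becomes symmetric in [d] and [e]. *)
transitivity (\sum_(d <- S) \sum_(e <- rem d S)
   ((f (incr q d) * cup s (incr q d) (rem e (rem d S)) +
     f (incr q e) * cup s (incr q e) (rem e (rem d S))) +
    (f (incr (incr q d) e) * cup s (incr (incr q d) e) (rem e (rem d S)) +
     f q * cup s q (rem e (rem d S))))).
  rewrite -big_split /=; apply: eq_big_seq => d dS.
  have ur := rem_uniq d uS.
  rewrite !big_split /= -!mulr_sumr -(IH (incr q d)) ?sz // -(IH q) ?sz //.
  rewrite !mulr_sumr -!big_split /=; apply: eq_bigr => e _.
  by rewrite !F2_oppr; ring.
apply: sum_sym_rem => // d e.
by rewrite incrC [rem e (rem d S)]remC //; congr (_ + _); exact: addrC.
Qed.


(** Since the remaining factors form a cocycle, the product is the coboundary of [f] times the rest.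
    In this form a sum over the grid telescopes. *)
Lemma cup_stokes f s q S : uniq S -> size S = (size s).+1 ->
  cup (f :: s) q S =
  \sum_(d <- S) (f (incr q d) * cup s (incr q d) (rem d S)
                 - f q * cup s q (rem d S)).
Proof.
move=> uS sS /=.
under eq_bigr => d _ do rewrite mulrBl.
by rewrite !sumrB -!mulr_sumr cup_closed.
Qed.

(** The cube lies in the hyperplane [x d = q d], on which the coboundary of [f] vanishes. *)
Lemma cup_const (s : seq ((nat -> nat) -> 'F_2)) q S f d c : d \notin S -> f \in s ->
  (forall x, x d = q d -> f x = c) -> cup s q S = 0.
Proof.
elim: s q S => //= g s IH q S dS; rewrite inE => fs fc.
rewrite big_seq big1 // => e eS.
have qed : incr q e d = q d.
  by rewrite incrE; case: eqP => // de; move: dS; rewrite de eS.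
case/orP: fs => [/eqP <-|fs]; first by rewrite !fc // subrr mul0r.
rewrite (IH (incr q e)) ?mulr0 //; last by move=> x; rewrite qed; exact: fc.
by apply: contra dS => /mem_rem.
Qed.

(** A nonzero term of the product is a path of edges starting at [q], along whose successive edges
    the successive functions change value. *)
Lemma cup_neq0 s q S : uniq S -> cup s q S != 0 ->
  forall i, (i < size s)%N -> exists x y,
    [/\ forall k, (q k <= x k <= (k \in S) + q k)%N,
        forall k, (q k <= y k <= (k \in S) + q k)%N &
        nth (fun=> 0) s i x != nth (fun=> 0) s i y].
Proof.
elim: s q S => //= f s IH q S uS cN0 i.
have [d dS dN0] : exists2 d, d \in S &
    (f (incr q d) - f q) * cup s (incr q d) (rem d S) != 0.
  apply/hasP; apply: contraNT cN0 => /hasPn h.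
  by rewrite big_seq big1 // => d /h; rewrite negbK => /eqP.
move: dN0; rewrite mulf_eq0 negb_or subr_eq0 => /andP[fN cN].
case: i => [_|i si] /=.
  exists (incr q d), q; split=> // k; rewrite ?leqnn ?leq_addl //.
  rewrite incrE leq_addl leq_add2r; case: eqP => // ->; by rewrite dS.
have [x [y [qx qy xy]]] := IH (incr q d) _ (rem_uniq d uS) cN i si.
have sub z : (forall k, incr q d k <= z k <= (k \in rem d S) + incr q d k)%N ->
    (forall k, q k <= z k <= (k \in S) + q k)%N.
  move=> qz k; have /andP[] := qz k; rewrite mem_rem_uniq // inE incrE.
  case: eqP => [->|_] /= z1 z2; first by rewrite dS z2 andbT ltnW.
  by rewrite z1 z2.
by exists x, y; split=> //; apply: sub.
Qed.

(** * Sums over boxes of the grid and Kuhn's lemma *)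

Section BoxSum.
Variable p : nat.

Fixpoint box_sum (S : seq nat) (F : (nat -> nat) -> 'F_2) (b : nat -> nat) : 'F_2 :=
  if S is d :: S' then \sum_(0 <= i < p) box_sum S' F (upd b d i) else F b.

Lemma updC x d i e j : d != e -> upd (upd x d i) e j = upd (upd x e j) d i.
Proof.
move=> de; apply/funext => k; rewrite /upd; case: (eqVneq k e) => // ->.
by rewrite eq_sym (negbTE de).
Qed.

Lemma upd_id x d i j : upd (upd x d i) d j = upd x d j.
Proof. by apply/funext => k; rewrite /upd; case: eqP. Qed.

Lemma box_sum_rem S d F b : uniq S -> d \in S ->
  box_sum S F b = \sum_(0 <= i < p) box_sum (rem d S) F (upd b d i).
Proof.
elim: S b => //= e S IH b /andP[eS uS]; rewrite inE => /orP[/eqP ->|dS].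
  by rewrite eqxx.
have ed : e != d by apply: contraNneq eS => ->.
rewrite (negbTE ed) /=.
under eq_bigr => i _ do rewrite IH //.
rewrite exchange_big; apply: eq_bigr => i _; apply: eq_bigr => j _.
by rewrite updC.
Qed.

Lemma eq_box_sum S F G b :
  (forall x, (forall k, k \notin S -> x k = b k) -> F x = G x) ->
  box_sum S F b = box_sum S G b.
Proof.
elim: S b => [|d S IH] b FG /=; first exact: FG.
apply: eq_bigr => i _; apply: IH => x xb; apply: FG => k.
by rewrite inE negb_or => /andP[kd kS]; rewrite xb // /upd (negbTE kd).
Qed.

Lemma box_sum_upd S F b d i : d \notin S ->
  box_sum S F (upd b d i) = box_sum S (fun x => F (upd x d i)) b.
Proof.
elim: S b => //= e S IH b; rewrite inE negb_or => /andP[de dS].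
by apply: eq_bigr => j _; rewrite updC // IH.
Qed.

Lemma box_sum0 S b : box_sum S (fun=> 0) b = 0.
Proof. by elim: S b => //= d S IH b; rewrite big1 // => i _. Qed.

Lemma box_sum_sum (T : eqType) (r : seq T) S F b :
  box_sum S (fun x => \sum_(t <- r) F t x) b = \sum_(t <- r) box_sum S (F t) b.
Proof.
elim: S b => //= d S IH b; rewrite exchange_big /=; apply: eq_bigr => i _.
exact: IH.
Qed.

Lemma box_sumB S F G b :
  box_sum S (fun x => F x - G x) b = box_sum S F b - box_sum S G b.
Proof.
by elim: S b => //= d S IH b; rewrite -sumrB; apply: eq_bigr => i _.
Qed.

Lemma box_sum_telescope S d (h : (nat -> nat) -> 'F_2) b : uniq S -> d \in S ->
  box_sum S (fun q => h (incr q d) - h q) b =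
  box_sum (rem d S) h (upd b d p) - box_sum (rem d S) h (upd b d 0).
Proof.
move=> uS dS; rewrite (box_sum_rem _ _ uS dS).
have dr : d \notin rem d S by rewrite mem_rem_uniqF.
under eq_bigr => i _.
  rewrite box_sumB.
  rewrite (@eq_box_sum _ (fun q => h (incr q d)) (fun q => h (upd q d i.+1))); last first.
    move=> x xb; congr h; rewrite /incr xb //.
    by rewrite /upd eqxx.
  rewrite -box_sum_upd // upd_id.
  over.
by rewrite telescope_sumr.
Qed.

(** By Stokes only boundary faces remain. On a face orthogonal to [e != d] the factor [f e] is
    constant, and on [x d = 0] the factor [f d] is 0. On [x d = p] it is 1, which leaves the same
    sum in one dimension less. *)
Lemma box_sum_cup S (f : nat -> (nat -> nat) -> 'F_2) b : uniq S ->
  (forall i x, i \in S -> x i = 0%N -> f i x = 0) ->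
  (forall i x, i \in S -> x i = p -> f i x = 1) ->
  box_sum S (fun q => cup (map f S) q S) b = 1.
Proof.
elim: S b => [//|d S IH] b udS f0 f1.
have /andP[dS uS] := udS.
have dup x i : upd x d i d = i by rewrite /upd eqxx.
transitivity (box_sum (d :: S) (fun q => \sum_(e <- d :: S)
   (f d (incr q e) * cup (map f S) (incr q e) (rem e (d :: S))
    - f d q * cup (map f S) q (rem e (d :: S)))) b).
  apply: eq_box_sum => x _; rewrite -cup_stokes //= size_map //.
rewrite box_sum_sum.
rewrite (eq_big_seq (fun e =>
   box_sum (rem e (d :: S)) (fun q => f d q * cup (map f S) q (rem e (d :: S))) (upd b e p)
   - box_sum (rem e (d :: S)) (fun q => f d q * cup (map f S) q (rem e (d :: S))) (upd b e 0%N))); last first.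
  move=> e eS.
  by rewrite (box_sum_telescope (fun q => f d q * cup (map f S) q (rem e (d :: S)))).
rewrite big_cons [X in _ + X]big_seq [X in _ + X]big1 ?addr0; last first.
  move=> e eS; have edS : e \in d :: S by rewrite inE eS orbT.
  have vanish i : i = 0%N \/ i = p ->
      box_sum (rem e (d :: S)) (fun q => f d q * cup (map f S) q (rem e (d :: S))) (upd b e i) = 0.
    move=> i0p; rewrite -[RHS](box_sum0 (rem e (d :: S)) (upd b e i)).
    have ner : e \notin rem e (d :: S) by rewrite mem_rem_uniqF.
    apply: eq_box_sum => x xb; have xe : x e = i by rewrite xb // /upd eqxx.
    rewrite (@cup_const _ _ _ (f e) e (if i == 0%N then 0 else 1)) ?mulr0 //.
      exact: map_f.
    move=> y; rewrite xe => ye; case: eqP => i0; first by rewrite f0 // ye.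
    by rewrite f1 // ye; case: i0p.
  by rewrite !vanish ?subrr //; [left|right].
rewrite /= eqxx -[RHS](IH (upd b d p) uS); first last.
- by move=> i x iS; apply: f1; rewrite inE iS orbT.
- by move=> i x iS; apply: f0; rewrite inE iS orbT.
rewrite -[RHS]subr0; congr (_ - _).
  apply: eq_box_sum => x xb; rewrite f1 ?mul1r ?inE ?eqxx //.
  by rewrite xb.
rewrite -[RHS](box_sum0 S (upd b d 0%N)).
apply: eq_box_sum => x xb; rewrite f0 ?mul0r ?inE ?eqxx //.
by rewrite xb.
Qed.

Lemma box_sum_neq0 S F b : uniq S -> box_sum S F b != 0 ->
  exists q, [/\ forall k, k \in S -> (q k < p)%N,
    forall k, k \notin S -> q k = b k & F q != 0].
Proof.
elim: S b => [|d S IH] b /= uS bN0; first by exists b.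
move/andP: uS => [dS uS].
have [i ip iN0] : exists2 i, (i < p)%N & box_sum S F (upd b d i) != 0.
  have [j] : exists2 i, i \in index_iota 0 p & box_sum S F (upd b d i) != 0.
    apply/hasP; apply: contraNT bN0 => /hasPn h.
    by rewrite big_seq big1 // => i /h; rewrite negbK => /eqP.
  by rewrite mem_index_iota => jp; exists j.
have [q [qS qb qN]] := IH _ uS iN0; exists q; split=> // k.
  rewrite inE => /orP[/eqP ->|]; last exact: qS.
  by rewrite qb // /upd eqxx.
by rewrite inE negb_or => /andP[kd kS]; rewrite qb // /upd (negbTE kd).
Qed.

End BoxSum.

(** The cup products of the labels add up to 1 mod 2, so some cube contributes, and on it no label
    is constant. The summand [(k < n)] is a truth value read as 0 or 1: coordinates from [n] on stay
    fixed. *)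
Lemma kuhn n p (f : nat -> (nat -> nat) -> bool) :
  (forall i x, (i < n)%N -> x i = 0%N -> f i x = false) ->
  (forall i x, (i < n)%N -> x i = p -> f i x = true) ->
  exists q : nat -> nat, (forall i, (i < n)%N -> (q i < p)%N) /\
    forall i, (i < n)%N -> exists x y,
    [/\ forall k, (q k <= x k <= (k < n) + q k)%N,
        forall k, (q k <= y k <= (k < n) + q k)%N &
        f i x != f i y].
Proof.
move=> f0 f1.
pose g i x : 'F_2 := (f i x)%:R.
have : box_sum p (iota 0 n) (fun q => cup (map g (iota 0 n)) q (iota 0 n)) (fun=> 0%N) != 0.
  rewrite box_sum_cup ?oner_eq0 ?iota_uniq // => i x; rewrite mem_iota add0n => /andP[_ i_n].
    by move=> /f0 xi; rewrite /g xi.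
  by move=> /f1 xi; rewrite /g xi.
move/(box_sum_neq0 (iota_uniq 0 n)) => [q [qp _ qN]].
exists q; split=> [i i_n|i i_n]; first by apply: qp; rewrite mem_iota.
have [||x [y [qx qy]]] := cup_neq0 _ qN (i := i).
- exact: iota_uniq.
- by rewrite size_map size_iota.
rewrite (nth_map 0%N) ?size_iota // nth_iota // add0n => xy.
exists x, y; split=> [k|k|].
- by have := qx k; rewrite mem_iota.
- by have := qy k; rewrite mem_iota.
by apply: contraNneq xy; rewrite /g => ->.
Qed.

(** * Approximate zeros of maps close to the identity *)

Section MaxNorm.
Variable R : realType.

Lemma rV_coord_le n (x : 'rV[R]_n) i : `|x 0 i| <= `|x|.
Proof.
rewrite [leRHS]/Num.norm /= mx_normrE; apply/bigmax_geP; right => /=.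
by exists (0, i).
Qed.

Lemma rV_norm_le n (x : 'rV[R]_n) a :
  0 <= a -> (forall i, `|x 0 i| <= a) -> `|x| <= a.
Proof.
move=> a0 xa; rewrite [leLHS]/Num.norm /= mx_normrE; apply/bigmax_leP; split=> //.
by move=> [i j] _ /=; rewrite (ord1 i).
Qed.

(** On the face [x 0 i = r] the bound on [h x - x] makes the [i]-th coordinate of [h] nonnegative,
    on the opposite face nonpositive. Kuhn's lemma for the signs then yields a small cube on which
    every coordinate of [h] takes both weak signs. *)
Lemma almost_zero n (h : 'rV[R]_n.+1 -> 'rV[R]_n.+1) (r A : R) :
  0 < r -> 0 <= A ->
  (forall x, `|x| <= r -> `|h x - x| <= r) ->
  (forall x y, `|x| <= r -> `|y| <= r -> `|h x - h y| <= A * `|x - y|) ->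
  forall e, 0 < e -> exists x, `|x| <= r /\ `|h x| <= e.
Proof.
move=> r0 A0 hr hA e e0.
(* The cells have side [2 * r / p], so twice the change of [h] across a cell is at most [e]. *)
pose p := (Num.bound (4 * r * A / e)).+1.
have p0 : 0 < p%:R :> R by rewrite ltr0n.
have pe : 4 * r * A / p%:R <= e.
  rewrite ler_pdivrMr // [e * _]mulrC -ler_pdivrMr //.
  have /ltW/le_trans := archi_boundP (divr_ge0 (mulr_ge0 (mulr_ge0 (ler0n R 4) (ltW r0)) A0) (ltW e0)).
  by apply; rewrite ler_nat /p.
pose X (g : nat -> nat) : 'rV[R]_n.+1 := \row_i (- r + 2 * r * (g i)%:R / p%:R).
have Xr g : (forall i, (i < n.+1)%N -> (g i <= p)%N) -> `|X g| <= r.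
  move=> gp; apply: rV_norm_le; first exact: ltW.
  move=> i; rewrite mxE.
  have g0 : 0 <= (g i)%:R / p%:R :> R by rewrite divr_ge0.
  have g1 : (g i)%:R / p%:R <= 1 :> R by rewrite ler_pdivrMr // mul1r ler_nat gp.
  rewrite -mulrA ler_norml; nra.
(* The label is forced on the two extreme faces, where [h] may vanish; it still agrees with the weak
   sign there. *)
pose f (i : nat) (g : nat -> nat) : bool :=
  (g i != 0%N) && ((g i == p) || (0 < h (X g) 0 (inord i))).
have [||q [qp qf]] := @kuhn n.+1 p f.
- by move=> i x _ xi; rewrite /f xi.
- by move=> i x _ xi; rewrite /f xi eqxx.
have qr : `|X q| <= r by apply: Xr => i /qp/ltnW.
exists (X q); split=> //; apply: rV_norm_le; first exact: ltW.
move=> i.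
have [x [y [qx qy xy]]] := qf i (ltn_ord i).
pose s := 2 * r / p%:R.
have s0 : 0 <= s by rewrite divr_ge0 // mulr_ge0 // ltW.
have near g : (forall k, (q k <= g k <= (k < n.+1)%N + q k)%N) ->
    `|X g| <= r /\ `|h (X g) - h (X q)| <= A * s.
  move=> qg; have gp : `|X g| <= r.
    apply: Xr => j jn; have /andP[_ /leq_trans] := qg j; apply.
    by rewrite jn add1n; apply: qp.
  split=> //; apply: le_trans (hA _ _ gp qr) _; apply: ler_wpM2l => //.
  apply: rV_norm_le => // j; rewrite !mxE.
  have /andP[g1 g2] := qg j; rewrite ltn_ord add1n in g2.
  have g1' : (q j)%:R <= (g j)%:R :> R by rewrite ler_nat.
  have g2' : (g j)%:R <= (q j)%:R + 1 :> R by rewrite natr1 ler_nat.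
  have -> : - r + 2 * r * (g j)%:R / p%:R - (- r + 2 * r * (q j)%:R / p%:R) =
     s * ((g j)%:R - (q j)%:R) by rewrite /s; field; rewrite gt_eqF.
  by rewrite ler_norml; nra.
have fT g : (forall k, (q k <= g k <= (k < n.+1)%N + q k)%N) ->
    f i g -> 0 <= h (X g) 0 i.
  move=> qg /andP[_ /orP[/eqP gp|]]; last by rewrite inord_val => /ltW.
  have [gr _] := near _ qg.
  have := le_trans (rV_coord_le _ i) (hr _ gr).
  rewrite !mxE gp ler_norml => /andP[+ _].
  have -> : - r + 2 * r * p%:R / p%:R = r by field; rewrite gt_eqF.
  lra.
have fF g : (forall k, (q k <= g k <= (k < n.+1)%N + q k)%N) ->
    ~~ f i g -> h (X g) 0 i <= 0.
  move=> qg; rewrite negb_and negbK => /orP[/eqP gp|]; last first.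
    by rewrite negb_or -leNgt inord_val => /andP[].
  have [gr _] := near _ qg.
  have := le_trans (rV_coord_le _ i) (hr _ gr).
  rewrite !mxE gp ler_norml => /andP[_].
  lra.
have [hx hy] := (near _ qx, near _ qy).
have {hx} := le_trans (rV_coord_le _ i) hx.2.
have {hy} := le_trans (rV_coord_le _ i) hy.2.
rewrite !mxE.
have As : A * s <= e.
  apply: le_trans pe.
  have -> : 4 * r * A / p%:R = A * s + A * s by rewrite /s; field; rewrite gt_eqF.
  by rewrite lerDl mulr_ge0.
have : (0 <= h (X x) 0 i /\ h (X y) 0 i <= 0) \/ (0 <= h (X y) 0 i /\ h (X x) 0 i <= 0).
  case fx: (f i x) xy; case fy: (f i y) => // _; [left|right]; split;
  by [apply: fT|apply: fF => //; rewrite ?fx ?fy].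
rewrite !ler_norml.
move=> H /andP[? ?] /andP[? ?]; apply/andP.
by case: H => -[? ?]; split; lra.
Qed.

End MaxNorm.

(** * Lipschitz extension, and images of spheres under Lipschitz maps *)

Section Lipschitz.
Variable R : realType.

(** McShane's formula: [G y] is the infimum of [f x + L * |y - phi x|]. Extending along [phi] covers
    both a Lipschitz map ([phi = id]) and the inverse of a bi-Lipschitz map ([f = id]). *)
Lemma mcshane T (D : set T) (f : T -> R) n (phi : T -> 'rV[R]_n) (L : R) :
  0 <= L -> D !=set0 ->
  (forall x x', D x -> D x' -> `|f x - f x'| <= L * `|phi x - phi x'|) ->
  exists G : 'rV[R]_n -> R, (forall x, D x -> G (phi x) = f x) /\
    forall y y', `|G y - G y'| <= L * `|y - y'|.
Proof.
move=> L0 [x0 Dx0] fL.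
pose E y := [set f x + L * `|y - phi x| | x in D].
have tri (y y' z : 'rV[R]_n) : L * `|y - z| <= L * `|y - y'| + L * `|y' - z|.
  by rewrite -mulrDr ler_wpM2l // ler_distD.
have Elb y x : D x -> lbound (E y) (f x - L * `|y - phi x|).
  move=> Dx _ [x' Dx' <-].
  have := fL _ _ Dx Dx'; rewrite ler_norml => /andP[_].
  have := tri (phi x) y (phi x'); rewrite (distrC (phi x) y).
  lra.
have Einf y : has_inf (E y).
  split; first by exists (f x0 + L * `|y - phi x0|), x0.
  by exists (f x0 - L * `|y - phi x0|); apply: Elb.
have Ele y x : D x -> inf (E y) <= f x + L * `|y - phi x|.
  by move=> Dx; apply: ge_inf; [case: (Einf y)|exists x].
have Gle y y' : inf (E y) - inf (E y') <= L * `|y - y'|.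
  rewrite lerBlDl -lerBlDr; apply: lb_le_inf; first by case: (Einf y').
  move=> _ [x Dx <-]; rewrite lerBlDr; apply: le_trans (Ele y x Dx) _.
  by rewrite -addrA lerD2l addrC tri.
exists (fun y => inf (E y)); split=> [x Dx|y y']; last first.
  by rewrite ler_norml Gle lerNl opprB distrC Gle.
apply/eqP; rewrite eq_le; apply/andP; split.
  by have := Ele (phi x) x Dx; rewrite subrr normr0 mulr0 addr0.
apply: lb_le_inf; first by case: (Einf (phi x)).
by have := Elb (phi x) x Dx; rewrite subrr normr0 mulr0 subr0.
Qed.

Lemma mcshane_rV T (D : set T) m (f : T -> 'rV[R]_m) n (phi : T -> 'rV[R]_n) (L : R) :
  0 <= L -> D !=set0 ->
  (forall x x', D x -> D x' -> `|f x - f x'| <= L * `|phi x - phi x'|) ->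
  exists G : 'rV[R]_n -> 'rV[R]_m, (forall x, D x -> G (phi x) = f x) /\
    forall y y', `|G y - G y'| <= L * `|y - y'|.
Proof.
move=> L0 D0 fL.
have Gi i := @mcshane T D (fun x => f x 0 i) n phi L L0 D0.
have {}Gi i : exists G : 'rV[R]_n -> R, (forall x, D x -> G (phi x) = f x 0 i) /\
    forall y y', `|G y - G y'| <= L * `|y - y'|.
  apply: Gi => x x' Dx Dx'; apply: le_trans (fL _ _ Dx Dx').
  by have := rV_coord_le (f x - f x') i; rewrite !mxE.
have [G HG] := choice Gi.
exists (fun y => \row_i G i y); split=> [x Dx|y y'].
  by apply/rowP => i; rewrite mxE (HG i).1.
apply: rV_norm_le => [|i]; first by rewrite mulr_ge0.
by rewrite !mxE (HG i).2.
Qed.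

Lemma rV_norm_attained n (x : 'rV[R]_n.+1) : exists i, `|x 0 i| = `|x|.
Proof.
have [->|x0] := eqVneq x 0; first by exists ord0; rewrite mxE !normr0.
have [|[i j] /= xij] := @mx_norm_neq0 _ _ _ x.
  by rewrite -[mx_norm x]/(`|x|) normr_eq0.
by exists j; rewrite -(ord1 i) -xij.
Qed.

(* The image of the sphere is of dimension at most [n], so it misses points
   of every (n+1)-dimensional cube; grids of mesh 1/t make this quantitative. *)
Lemma lipschitz_sphere_gap n (G : 'rV[R]_n.+1 -> 'rV[R]_n.+1) c (L eps eta : R) :
  0 <= L -> 0 < eps -> 0 < eta ->
  (forall y y', `|G y - G y'| <= L * `|y - y'|) ->
  exists v g, [/\ `|v| <= eta, 0 < g &
    forall y, `|y - c| = eps -> g <= `|G y - v|].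
Proof.
move=> L0 eps0 eta0 GL.
pose A := (Num.bound (4 * L * eps / eta)).+1.
(* There are [t ^ n.+1] candidates [v j] with spacing [eta / t], but at most
   [2 * n.+1 * (A.+1 * t) ^ n] cells on the sphere, which is fewer. The choice of [A] makes [G] vary
   by at most [eta / (2 * t)] on a cell; together with two errors below [g] this stays below the
   spacing, so distinct [j] need distinct cells. *)
pose t := (2 * n.+1 * A.+1 ^ n).+1.
pose m := (A * t)%N.
pose g := eta / (4 * t%:R).
have t0 : 0 < t%:R :> R by rewrite ltr0n.
have m0 : 0 < m%:R :> R by rewrite ltr0n muln_gt0.
have g0 : 0 < g by rewrite divr_gt0 // mulr_gt0.
pose v (j : {ffun 'I_n.+1 -> 'I_t}) : 'rV[R]_n.+1 := \row_i (eta * (j i)%:R / t%:R).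
have veta j : `|v j| <= eta.
  apply: rV_norm_le => [|i]; first exact: ltW.
  rewrite mxE ger0_norm; last by rewrite divr_ge0 // mulr_ge0 // ltW.
  by rewrite ler_pdivrMr // ler_wpM2l ?(ltW eta0) // ler_nat ltnW.
apply: contrapT => H.
have Y j : exists y, `|y - c| = eps /\ `|G y - v j| < g.
  apply: contrapT => Hj; apply: H; exists (v j), g; split=> // y yc.
  by rewrite leNgt; apply/negP => yg; apply: Hj; exists y.
have [y Hy] := choice Y.
have I j := rV_norm_attained (y j - c).
have [i Hi] := choice I.
pose idx j k := Num.truncn (((y j - c) 0 k + eps) / (2 * eps) * m%:R).
have yb j k : - eps <= (y j - c) 0 k <= eps.
  by rewrite -ler_norml -(Hy j).1 rV_coord_le.
have idx0 j k : 0 <= ((y j - c) 0 k + eps) / (2 * eps) * m%:R.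
  have := yb j k => /andP[h1 h2].
  rewrite mulr_ge0 // divr_ge0 ?mulr_ge0 ?(ltW eps0) //; lra.
have idxP j k : (idx j k < m.+1)%N.
  have := yb j k => /andP[h1 h2].
  have /andP[] := Num.Theory.truncn_itv (idx0 j k).
  rewrite -/(idx j k) => h3 _; rewrite ltnS -(ler_nat R); apply: le_trans h3 _.
  rewrite -[leRHS]mul1r ler_wpM2r // ler_pdivrMr ?mulr_gt0 // mul1r; lra.
(* A cell is a face of the max-norm sphere, given by an extremal coordinate and its sign, and a grid
   index for the other [n] coordinates. *)
pose code j : 'I_n.+1 * bool * {ffun 'I_n -> 'I_m.+1} :=
  (i j, 0 <= (y j - c) 0 (i j), [ffun a => inord (idx j (lift (i j) a))]).
have code_inj : injective code.
  move=> j j' [ij sj /ffunP xj].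
  have yy : `|y j - y j'| <= 2 * eps / m%:R.
    apply: rV_norm_le => [|k]; first by rewrite divr_ge0 // mulr_ge0 // ltW.
    have -> : (y j - y j') 0 k = (y j - c) 0 k - (y j' - c) 0 k by rewrite !mxE; ring.
    have [a ka|ki] := unliftP (i j) k; last first.
      have [e1 e2] := (Hi j, Hi j'); rewrite (Hy _).1 in e1; rewrite (Hy _).1 in e2.
      rewrite ki; rewrite -ij in e2 sj.
      have -> : (y j - c) 0 (i j) = (y j' - c) 0 (i j).
        case: (lerP 0 ((y j - c) 0 (i j))) sj => s1 s2.
          by rewrite -(ger0_norm s1) e1 -e2 ger0_norm.
        rewrite -[LHS]opprK -(ltr0_norm s1) e1 -e2 ltr0_norm ?opprK //.
        by rewrite ltNge -s2.
      by rewrite subrr normr0 divr_ge0 // mulr_ge0 // ltW.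
    have idxE : idx j k = idx j' k.
      have := congr1 (@nat_of_ord _) (xj a); rewrite !ffunE -ij -ka !inordK //.
    have /andP[a1 a2] := Num.Theory.truncn_itv (idx0 j k).
    have /andP[b1 b2] := Num.Theory.truncn_itv (idx0 j' k).
    rewrite -/(idx _ _) idxE in a1 a2; rewrite -/(idx _ _) in b1 b2.
    set u := (y j - c) 0 k in a1 a2 *; set w := (y j' - c) 0 k in b1 b2 *.
    set N := idx j' k in a1 a2 b1 b2; rewrite -natr1 in a2 b2.
    have E x : (x + eps) / (2 * eps) * m%:R = (x + eps) / (2 * eps / m%:R).
      by field; rewrite !gt_eqF.
    rewrite !E in a1 a2 b1 b2.
    have s0 : 0 < 2 * eps / m%:R by rewrite divr_gt0 // mulr_gt0.
    move: (2 * eps / m%:R) s0 a1 a2 b1 b2 => s s0.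
    rewrite !ler_pdivlMr // !ltr_pdivrMr // => a1 a2 b1 b2.
    by rewrite ler_norml; nra.
  apply/ffunP => k; apply/val_inj/eqP.
  have vv : `|v j - v j'| < eta / t%:R.
    have -> : v j - v j' = (v j - G (y j)) + (G (y j) - G (y j')) + (G (y j') - v j').
      by rewrite !subrKA.
    apply: le_lt_trans (ler_normD _ _) _; apply: le_lt_trans (lerD (ler_normD _ _) (lexx _)) _.
    have h1 := (Hy j).2; have h2 := (Hy j').2; rewrite distrC in h1.
    have h3 := le_trans (GL (y j) (y j')) (ler_wpM2l L0 yy).
    have h4 : L * (2 * eps / m%:R) <= eta / t%:R / 2.
      have -> : m%:R = A%:R * t%:R :> R by rewrite natrM.
      have -> : L * (2 * eps / (A%:R * t%:R)) = (4 * L * eps / eta) / A%:R * (eta / t%:R / 2).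
        field; rewrite !gt_eqF // ltr0n.
      rewrite -[leRHS]mul1r ler_wpM2r ?divr_ge0 ?(ltW eta0) //.
      rewrite ler_pdivrMr ?ltr0n // mul1r.
      have /ltW/le_trans := archi_boundP (divr_ge0 (mulr_ge0 (mulr_ge0 (ler0n R 4) L0) (ltW eps0)) (ltW eta0)).
      by apply; rewrite ler_nat /A.
    have gE : g = eta / t%:R / 4 by rewrite /g; field; rewrite gt_eqF.
    move: h1 h2; rewrite gE; lra.
  have := le_lt_trans (rV_coord_le _ k) vv; rewrite !mxE.
  have -> : eta * (j k)%:R / t%:R - eta * (j' k)%:R / t%:R =
     eta / t%:R * ((j k)%:R - (j' k)%:R) by ring.
  rewrite normrM gtr0_norm ?divr_gt0 // -[ltRHS]mulr1 ltr_pM2l ?divr_gt0 //.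
  rewrite ltr_norml; case: (ltngtP (j k) (j' k)) => // jj.
    have : (j k)%:R + 1 <= (j' k)%:R :> R by rewrite natr1 ler_nat.
    by move=> ? /andP[? ?]; lra.
  have : (j' k)%:R + 1 <= (j k)%:R :> R by rewrite natr1 ler_nat.
  by move=> ? /andP[? ?]; lra.
have := leq_card code code_inj.
rewrite !card_prod !card_ffun !card_ord card_bool leqNgt => /negP; apply.
apply: (@leq_ltn_trans (2 * n.+1 * A.+1 ^ n * t ^ n)%N).
  rewrite [(n.+1 * 2)%N]mulnC -[leqRHS]mulnA -expnMn leq_mul2l; apply/orP; right; case: (n) => // k.
  by rewrite leq_exp2r // mulSn -addn1 addnC leq_add2r.
by rewrite expnS ltn_pmul2r ?expn_gt0.
Qed.

End Lipschitz.

(** * Invariance of domain for bi-Lipschitz maps *)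

Section InvarianceOfDomain.
Variable R : realType.

Lemma lipschitz_continuous (V W : normedModType R) (f : V -> W) (L : R) :
  (forall y y', `|f y - f y'| <= L * `|y - y'|) -> continuous f.
Proof.
move=> fL x; apply/cvgrPdist_le => e e0; near=> y.
apply: le_trans (fL _ _) _.
have L1 : 0 < `|L| + 1 by rewrite ltr_wpDl.
have : `|x - y| <= e / (`|L| + 1).
  by near: y; apply: cvgr_dist_le; [exact: cvg_id|rewrite divr_gt0].
rewrite ler_pdivlMr // => h; apply: le_trans h; rewrite mulrC ler_wpM2l //.
by apply: le_trans (ler_norm L) _; rewrite lerDl.
Unshelve. all: by end_near.
Qed.

Lemma compact_cball n (r : R) : compact [set x : 'rV[R]_n | `|x| <= r].
Proof.
apply: bounded_closed_compact.
  by exists r; split; [exact: num_real|move=> x rx y /= /le_trans; apply; exact: ltW].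
have -> : [set x : 'rV[R]_n | `|x| <= r] = (fun x => `|x|) @^-1` [set x : R | x <= r] by [].
apply: closed_comp; last exact: closed_le.
by move=> x _; exact: norm_continuous.
Qed.

Lemma compact_gap (V W : normedModType R) (K : set V) (f : V -> W) c :
  compact K -> continuous f -> (forall x, K x -> f x != c) ->
  exists d, 0 < d /\ forall x, K x -> d <= `|f x - c|.
Proof.
move=> cK cf fc.
have cl : closed (f @` K).
  apply: compact_closed; first exact: norm_hausdorff.
  by apply: continuous_compact => //; apply: continuous_subspaceT.
have nc : (~` (f @` K)) c by move=> [x /fc /eqP xc /xc].
have /nbhs_ballP[d /= d0 dK] := open_nbhs_nbhs (conj (closed_openC cl) nc).
exists d; split=> // x Kx; rewrite leNgt; apply/negP => xd.
by apply: (dK (f x)); [rewrite -ball_normE /= distrC|exists x].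
Qed.

(** The map fixes all points at distance at least [eps] from [c] and projects the others radially
    onto the sphere of radius [eps]. Its Lipschitz constant blows up only near [c], which the lower
    bound [d] avoids. *)
Lemma push_lipschitz n (c : 'rV[R]_n) (eps d D : R) :
  0 < d -> d <= eps -> 0 <= D ->
  exists A, 0 <= A /\ forall y y', d <= `|y - c| -> d <= `|y' - c| -> `|y' - c| <= D ->
  `|(c + (eps / Num.min `|y - c| eps) *: (y - c)) -
    (c + (eps / Num.min `|y' - c| eps) *: (y' - c))| <= A * `|y - y'|.
Proof.
move=> d0 de D0; have eps0 := lt_le_trans d0 de.
exists (eps / d + eps * D / d ^+ 2); split.
  by rewrite addr_ge0 // divr_ge0 ?mulr_ge0 ?exprn_ge0 // ltW.
move=> y y' dy dy' Dy'.
set u := y - c; set u' := y' - c.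
set m := Num.min _ _; set m' := Num.min _ _.
have dm : d <= m by rewrite le_min dy de.
have dm' : d <= m' by rewrite le_min dy' de.
have m0 := lt_le_trans d0 dm; have m'0 := lt_le_trans d0 dm'.
have uu : u - u' = y - y' by rewrite /u /u' opprB addrA subrK.
have -> : c + (eps / m) *: u - (c + (eps / m') *: u') =
   (eps / m) *: (u - u') + (eps / m * ((m' - m) / m')) *: u'.
  rewrite opprD addrACA subrr add0r; clear uu; clearbody u u'.
  by apply/rowP => k; rewrite !mxE; field; rewrite !gt_eqF.
apply: le_trans (ler_normD _ _) _; rewrite [leRHS]mulrDl; apply: lerD.
  rewrite normrZ uu ler_wpM2r // ger0_norm ?divr_ge0 ?(ltW eps0) ?(ltW m0) //.
  by rewrite ler_pM2l // lef_pV2.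
have mm : `|m' - m| <= `|y - y'|.
  rewrite -uu (distrC u); apply: le_trans (ler_dist_dist _ _).
  rewrite /m /m' -/u -/u'; move: `|u| `|u'| => a b; rewrite /Num.min.
  by do 2 case: ltP => ?; rewrite ler_norml; apply/andP; split;
     have := ler_norm (b - a); have := ler_norm (a - b); rewrite (distrC a b); lra.
rewrite normrZ.
have -> : eps * D / d ^+ 2 * `|y - y'| = (eps / d * (`|y - y'| / d)) * D.
  by field; rewrite gt_eqF.
apply: ler_pM => //.
rewrite normrM; apply: ler_pM => //.
  rewrite ger0_norm ?divr_ge0 ?(ltW eps0) ?(ltW m0) //.
  by rewrite ler_pM2l // lef_pV2.
rewrite normrM; apply: ler_pM => //.
by rewrite ger0_norm ?invr_ge0 ?(ltW m'0) // lef_pV2.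
Qed.

(* Were [c] close to [phi 0] and missed by [phi], a Lipschitz extension [G] of
   the inverse of [phi], composed with the push [Phi] away from [c] and
   translated by a small [v] off the image of the sphere, would give a
   nonvanishing map close to the identity on the ball. *)
Lemma bilipschitz_open n (phi : 'rV[R]_n.+1 -> 'rV[R]_n.+1) (r L : R) :
  0 < r -> 0 < L ->
  (forall x x', `|x| <= r -> `|x'| <= r ->
     `|phi x - phi x'| <= L * `|x - x'| /\ `|x - x'| <= L * `|phi x - phi x'|) ->
  exists e, 0 < e /\ forall c, `|c - phi 0| < e ->
    exists x, `|x| <= r /\ phi x = c.
Proof.
move=> r0 L0 bil.
pose K := [set x : 'rV[R]_n.+1 | `|x| <= r].
have K0 : K 0 by rewrite /K /= normr0 ltW.
have [phi' [phi'E phi'L]] : exists phi' : 'rV[R]_n.+1 -> 'rV[R]_n.+1,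
    (forall x, K x -> phi' x = phi x) /\ forall y y', `|phi' y - phi' y'| <= L * `|y - y'|.
  by apply: (@mcshane_rV _ _ K _ phi _ id L); [exact: ltW|exists 0|move=> x x' Kx Kx'; case: (bil x x')].
have [G [GE GL]] : exists G : 'rV[R]_n.+1 -> 'rV[R]_n.+1,
    (forall x, K x -> G (phi x) = x) /\ forall y y', `|G y - G y'| <= L * `|y - y'|.
  by apply: (@mcshane_rV _ _ K _ id _ phi L); [exact: ltW|exists 0|move=> x x' Kx Kx'; case: (bil x x')].
pose eps := r / (8 * L).
have eps0 : 0 < eps by rewrite divr_gt0 // mulr_gt0.
have Leps : L * eps = r / 8 by rewrite /eps; field; rewrite gt_eqF.
exists (eps / 2); split; first by rewrite divr_gt0.
move=> c ceps; apply: contrapT => Hc.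
have [d [d0 dK]] : exists d, 0 < d /\ forall x, K x -> d <= `|phi' x - c|.
  apply: compact_gap; first exact: compact_cball.
    exact: lipschitz_continuous phi'L.
  by move=> x Kx; apply/eqP => xc; apply: Hc; exists x; split=> //; rewrite -phi'E.
have {}dK x : K x -> d <= `|phi x - c| by move=> Kx; rewrite -phi'E // dK.
have de : d <= eps.
  by apply: le_trans (dK 0 K0) _; rewrite distrC; lra.
(* The first bound helps to keep [h] within [r] of the identity. By the second, [v] is at most half
   as long as any [x] whose image lies outside the [eps]-ball about [c], since such an [x] has norm
   at least [eps / (2 * L)]. *)
pose eta := Num.min (r / 4) (eps / (4 * L)).
have eta0 : 0 < eta by rewrite lt_min !divr_gt0 ?mulr_gt0.
have eta1 : eta <= r / 4 by rewrite ge_min lexx.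
have eta2 : eta <= eps / (4 * L) by rewrite ge_min lexx orbT.
have [v [g [veta g0 Hv]]] := lipschitz_sphere_gap c (ltW L0) eps0 eta0 GL.
pose Phi y := c + (eps / Num.min `|y - c| eps) *: (y - c).
pose h x := G (Phi (phi x)) - v.
have phiD x : K x -> `|phi x - c| <= L * r + eps.
  move=> Kx; apply: le_trans (ler_distD (phi 0) _ _) _; apply: lerD; last first.
    by rewrite distrC; lra.
  by apply: le_trans (bil _ _ Kx K0).1 _; rewrite subr0 ler_pM2l.
have [|A [A0 PhiL]] := @push_lipschitz _ c eps d (L * r + eps) d0 de.
  exact: addr_ge0 (mulr_ge0 (ltW L0) (ltW r0)) (ltW eps0).
have far x : eps <= `|phi x - c| -> Phi (phi x) = phi x.
  by move=> ex; rewrite /Phi min_r // divff ?gt_eqF // scale1r addrC subrK.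
have near x : K x -> `|phi x - c| < eps -> `|Phi (phi x) - c| = eps.
  move=> Kx ex; have c0 := lt_le_trans d0 (dK x Kx).
  rewrite /Phi addrC addKr (min_l (ltW ex)) normrZ.
  by rewrite (ger0_norm (divr_ge0 (ltW eps0) (ltW c0))) divfK // gt_eqF.
have xphi x : K x -> `|x| <= L * `|phi x - phi 0|.
  by move=> Kx; have := (bil _ _ Kx K0).2; rewrite subr0.
pose low := Num.min g (eps / (4 * L)).
have low0 : 0 < low by rewrite lt_min g0 /= divr_gt0 // mulr_gt0.
(* Inside the [eps]-ball about [c] the push lands on the sphere, whose image under [G] avoids [v] by
   [g]; outside it [h x] is [x - v]. *)
have hlow x : K x -> low <= `|h x|.
  move=> Kx; have [ex|ex] := leP eps `|phi x - c|; last first.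
    by rewrite ge_min Hv // near.
  rewrite ge_min /h far // GE //; apply/orP; right.
  have h1 : eps / 2 <= `|phi x - phi 0|.
    have := ler_distD (phi 0) (phi x) c; rewrite (distrC (phi 0) c); lra.
  have h2 : eps / 2 <= L * `|x|.
    by apply: le_trans h1 _; have := (bil _ _ Kx K0).1; rewrite subr0.
  have h3 : 2 * (eps / (4 * L)) <= `|x|.
    have -> : 2 * (eps / (4 * L)) = eps / 2 / L by field; rewrite gt_eqF.
    by rewrite ler_pdivrMr // [_ * L]mulrC.
  have := lerB_normD x (- v); rewrite normrN; lra.
have hid x : K x -> `|h x - x| <= r.
  move=> Kx; have [ex|ex] := leP eps `|phi x - c|.
    rewrite /h far // GE // addrAC subrr add0r normrN; lra.
  have h1 : `|phi x - phi 0| <= 3 / 2 * eps.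
    have := ler_distD c (phi x) (phi 0); lra.
  have h2 : `|x| <= 3 / 2 * (L * eps).
    by apply: le_trans (xphi x Kx) _; rewrite mulrCA ler_pM2l.
  have h3 : `|G (Phi (phi x))| <= 3 / 2 * (L * eps).
    have := GL (Phi (phi x)) (phi 0); rewrite GE // subr0 => /le_trans; apply.
    rewrite mulrCA ler_pM2l //.
    have := ler_distD c (Phi (phi x)) (phi 0); rewrite near //; lra.
  rewrite /h; have := ler_normB (G (Phi (phi x)) - v) x.
  have := ler_normB (G (Phi (phi x))) v; lra.
have hL x y : K x -> K y -> `|h x - h y| <= (L * (A * L)) * `|x - y|.
  move=> Kx Ky; rewrite /h opprB addrA subrK.
  apply: le_trans (GL _ _) _; rewrite -mulrA ler_pM2l //.
  apply: le_trans (PhiL _ _ (dK _ Kx) (dK _ Ky) (phiD _ Ky)) _.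
  by rewrite -mulrA ler_wpM2l //; case: (bil _ _ Kx Ky).
have [||x [Kx hx]] := almost_zero r0 _ hid hL (e := low / 2).
- exact: mulr_ge0 (ltW L0) (mulr_ge0 A0 (ltW L0)).
- by rewrite divr_gt0.
have := hlow x Kx; lra.
Qed.

End InvarianceOfDomain.

(** * Complex moduli and the homogeneous parametrization *)

Section Cone.
Variable R : realType.
Local Notation C := R[i].
Implicit Types z w s t : C.

Lemma normc_ge0 z : 0 <= normc z.
Proof. by case: z => a b; rewrite sqrtr_ge0. Qed.

(* [le_normcD] and [normcN] speak of the operations of [Rcomplex R]. *)
Lemma normcD z w : normc (z + w) <= normc z + normc w.
Proof. exact: le_normcD. Qed.

Lemma normc_opp z : normc (- z) = normc z.
Proof. exact: normcN. Qed.

Lemma normcB z w : normc (z - w) <= normc z + normc w.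
Proof. by rewrite -(normc_opp w); exact: normcD. Qed.

Lemma normcC z w : normc (z - w) = normc (w - z).
Proof. by rewrite -normc_opp opprB. Qed.

Lemma normc_tri z w t : normc (z - t) <= normc (z - w) + normc (w - t).
Proof. by have := normcD (z - w) (w - t); rewrite subrKA. Qed.

Lemma normc_real (a : R) : normc a%:C = `|a|.
Proof. by rewrite /normc /= expr0n /= addr0 sqrtr_sqr. Qed.

Lemma normcX z n : normc (z ^+ n) = normc z ^+ n.
Proof. by elim: n => [|n IH]; rewrite ?expr0 ?normc1 // !exprS normcM IH. Qed.

Lemma normcJ z : normc z^* = normc z.
Proof. by case: z => a b; rewrite /normc /= sqrrN. Qed.

Lemma mulcJ z : z * z^* = ((normc z) ^+ 2)%:C.
Proof.
case: z => a b; rewrite /normc sqr_sqrtr ?addr_ge0 ?sqr_ge0 //.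
by apply/eqP; rewrite eq_complex /=; apply/andP; split; apply/eqP; ring.
Qed.

Lemma normc_eq0 z : (normc z == 0) = (z == 0).
Proof. by apply/eqP/eqP => [/eq0_normc//|->]; rewrite normc0. Qed.

Lemma normc_distD z w : `|normc z - normc w| <= normc (z - w).
Proof.
have := normcD (z - w) w; have := normcD (w - z) z.
rewrite !subrK (normcC w) ler_norml => h1 h2; lra.
Qed.

Lemma realc_eq0 (a : R) : (a%:C == 0) = (a == 0).
Proof. by rewrite -(rmorph0 (real_complex R)) (inj_eq (@complexI R)). Qed.

(** Division by zero gives [dirc 0 = 0], so the polar decomposition and the products below hold at 0
    as well. *)
Definition dirc z : C := z / (normc z)%:C.

Lemma normc_dirc z : normc (dirc z) <= 1.
Proof.
rewrite /dirc normcM normcV normc_real ger0_norm ?normc_ge0 //.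
have [->|z0] := eqVneq (normc z) 0; first by rewrite mul0r.
by rewrite divff.
Qed.

Lemma dircK z : (normc z)%:C * dirc z = z.
Proof.
have [->|z0] := eqVneq z 0; first by rewrite /dirc normc0 !mul0r.
by rewrite mulrC divfK // realc_eq0 normc_eq0.
Qed.

(** A function homogeneous of degree 0 has a Lipschitz constant of order [1 / normc s]; the weight
    [normc s] compensates for it. *)
Lemma dirc_lipschitz s t : normc s * normc (dirc t - dirc s) <= 2 * normc (t - s).
Proof.
have -> : normc s * normc (dirc t - dirc s) = normc ((normc s)%:C * (dirc t - dirc s)).
  by rewrite normcM normc_real ger0_norm ?normc_ge0.
have -> : (normc s)%:C * (dirc t - dirc s) =
   (normc s - normc t)%:C * dirc t + (t - s).
  by rewrite mulrBr dircK -[X in _ + (X - s)]dircK rmorphB /= ; ring.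
apply: le_trans (normcD _ _) _; rewrite mulr_natl mulr2n lerD2r normcM normc_real.
apply: le_trans (_ : normc (t - s) * 1 <= _); last by rewrite mulr1.
by apply: ler_pM; rewrite ?normc_ge0 ?normc_dirc // normcC normc_distD.
Qed.

Lemma mul_dirc_lipschitz s t :
  normc (t * dirc t - s * dirc s) <= 3 * normc (t - s).
Proof.
have -> : t * dirc t - s * dirc s = (t - s) * dirc t + s * (dirc t - dirc s) by ring.
apply: le_trans (normcD _ _) _; rewrite (normcM (t - s)) (normcM s).
have := dirc_lipschitz s t; have := ler_wpM2l (normc_ge0 (t - s)) (normc_dirc t).
lra.
Qed.

Lemma mul_dirc2_lipschitz s t :
  normc (t * dirc t ^+ 2 - s * dirc s ^+ 2) <= 5 * normc (t - s).
Proof.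
have -> : t * dirc t ^+ 2 - s * dirc s ^+ 2 =
  (t * dirc t - s * dirc s) * dirc t + (s * (dirc t - dirc s)) * dirc s by ring.
apply: le_trans (normcD _ _) _; rewrite (normcM (t * _ - _)) (normcM (s * _)) (normcM s).
have := dirc_lipschitz s t; have := mul_dirc_lipschitz s t.
have := ler_wpM2l (normc_ge0 (t * dirc t - s * dirc s)) (normc_dirc t).
have := ler_wpM2l (mulr_ge0 (normc_ge0 s) (normc_ge0 (dirc t - dirc s))) (normc_dirc s).
lra.
Qed.

(** This is the estimate for the inverse parametrization. Equal moduli, as on the cone, turn the
    weight [normc z'] into the [normc w'] that [dirc_lipschitz] requires. *)
Lemma conj_dirc_lipschitz z w z' w' : normc z' = normc w' ->
  normc (z * (dirc w)^* - z' * (dirc w')^*) <= normc (z - z') + 2 * normc (w - w').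
Proof.
move=> zw.
have -> : z * (dirc w)^* - z' * (dirc w')^* =
  (z - z') * (dirc w)^* + z' * (dirc w - dirc w')^* by rewrite rmorphB /=; ring.
apply: le_trans (normcD _ _) _; rewrite (normcM (z - _)) (normcM z') !normcJ zw.
have := dirc_lipschitz w' w; have := ler_wpM2l (normc_ge0 (z - z')) (normc_dirc w).
lra.
Qed.

Lemma normc_dirc1 z : z != 0 -> normc (dirc z) = 1.
Proof.
move=> z0; rewrite /dirc normcM normcV normc_real.
by rewrite ger0_norm ?normc_ge0 // divff // normc_eq0.
Qed.

Lemma dirc0 : dirc 0 = 0. Proof. by rewrite /dirc mul0r. Qed.

Lemma mul_dirc_norm t : normc (t * dirc t) = normc t.
Proof.
have [->|t0] := eqVneq t 0; first by rewrite mul0r.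
by rewrite normcM normc_dirc1 // mulr1.
Qed.

Lemma mul_dirc2_norm t : normc (t * dirc t ^+ 2) = normc t.
Proof.
have [->|t0] := eqVneq t 0; first by rewrite mul0r.
by rewrite normcM normcX normc_dirc1 // expr1n mulr1.
Qed.

(** The direction of [t * dirc t] is [dirc t ^+ 2], which cancels against its conjugate. *)
Lemma cone_inv t : t * dirc t ^+ 2 * (dirc (t * dirc t))^* = t.
Proof.
have [->|t0] := eqVneq t 0; first by rewrite !mul0r.
have -> : dirc (t * dirc t) = dirc t ^+ 2.
  by rewrite {1}/dirc mul_dirc_norm mulrAC -/(dirc t) expr2.
by rewrite -mulrA mulcJ normcX normc_dirc1 // !expr1n mulr1.
Qed.

(* The homogenized cuspidal curve is the cone over the trefoil. *)
Lemma cone_of_cusp z w :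
  (w * (normc w)%:C) ^+ 3 = (z * ((normc z) ^+ 2)%:C) ^+ 2 ->
  exists t, z = t * dirc t ^+ 2 /\ w = t * dirc t.
Proof.
move=> E.
have zw : normc z = normc w.
  have := congr1 (@normc R) E.
  rewrite !(normcX, normcM) !normc_real !ger0_norm ?exprn_ge0 ?normc_ge0 //.
  move=> {}E; apply: (@pexpIrn _ 6) => //; rewrite ?nnegrE ?normc_ge0 //.
  rewrite (_ : normc z ^+ 6 = (normc z * normc z ^+ 2) ^+ 2); last by ring.
  by rewrite -E; ring.
have [z0|z0] := eqVneq z 0.
  exists 0; rewrite dirc0 !mul0r; split=> //.
  by apply: eq0_normc; rewrite -zw z0 normc0.
have rho0 : (normc z)%:C != 0 by rewrite realc_eq0 normc_eq0.
have w3 : w ^+ 3 = z ^+ 2 * (normc z)%:C.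
  apply: (mulIf (expf_neq0 3 rho0)); move: E; rewrite -zw rmorphXn /= !exprMn => ->.
  by ring.
(* The conjugates of [z] and [w] are kept only through these relations, so that [ring] and [field]
   see plain variables. The witness below is [z] times the conjugate of [dirc w], because [w] and
   [z] have equal moduli. *)
have [zb [wb [w3' zz ww wbn]]] : exists zb wb : C,
    [/\ wb ^+ 3 = zb ^+ 2 * (normc z)%:C, z * zb = (normc z)%:C ^+ 2,
        w * wb = (normc z)%:C ^+ 2 & normc wb = normc z].
  exists z^*, w^*; split; last by rewrite normcJ zw.
  - by rewrite -rmorphXn w3 rmorphM rmorphXn; congr (_ * _); exact: conjc_real.
  - by rewrite mulcJ rmorphXn.
  - by rewrite mulcJ -zw rmorphXn.
have tn : normc (z * wb / (normc z)%:C) = normc z.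
  rewrite normcM normcM wbn normcV normc_real.
  by rewrite ger0_norm ?normc_ge0 // mulfK // normc_eq0.
exists (z * wb / (normc z)%:C); rewrite /dirc tn; move: rho0 w3 w3' zz ww.
move: (normc z)%:C => r r0 w3 w3' zz ww; split.
  transitivity (z * (z ^+ 2 * wb ^+ 3) / r ^+ 5); last by field.
  rewrite w3' (_ : z ^+ 2 * (zb ^+ 2 * r) = (z * zb) ^+ 2 * r); last by ring.
  by rewrite zz; field.
transitivity ((z ^+ 2 * r) * wb ^+ 2 / r ^+ 4); last by field.
rewrite -w3 (_ : w ^+ 3 * wb ^+ 2 = w * (w * wb) ^+ 2); last by ring.
by rewrite ww; field.
Qed.

End Cone.

(** * Passage from the Euclidean norm to the max norm *)

Section EuclideanNorm.
Variable R : realType.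

Lemma norm_le_enorm n (x : 'rV[R]_n) : `|x| <= enorm x.
Proof.
apply: rV_norm_le => [|i]; first exact: sqrtr_ge0.
rewrite -sqrtr_sqr ler_wsqrtr // (bigD1 i) //= lerDl.
by apply: sumr_ge0 => j _; exact: sqr_ge0.
Qed.

Lemma enorm_le_norm n (x : 'rV[R]_n) : enorm x <= n.+1%:R * `|x|.
Proof.
have -> : n.+1%:R * `|x| = Num.sqrt ((n.+1%:R * `|x|) ^+ 2).
  by rewrite sqrtr_sqr ger0_norm // mulr_ge0.
apply: ler_wsqrtr; apply: (@le_trans _ _ (\sum_(i < n) `|x| ^+ 2)).
  by apply: ler_sum => i _; rewrite -real_normK ?num_real // ler_sqr ?nnegrE // rV_coord_le.
rewrite sumr_const card_ord -[X in X <= _]mulr_natl exprMn ler_wpM2r ?sqr_ge0 // -natrX ler_nat.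
by rewrite (leq_trans (leqnSn n)) // -{1}(expn1 n.+1) leq_pexp2l.
Qed.

Lemma is_lipschitzP n m (X : set 'rV[R]_n) (f : 'rV[R]_n -> 'rV[R]_m) :
  is_lipschitz X f <-> exists l : R, 0 < l /\
    forall x y, X x -> X y -> `|f x - f y| <= l * `|x - y|.
Proof.
split=> -[l [l0 fl]].
  exists (l * n.+1%:R); split=> [|x y Xx Xy]; first by rewrite mulr_gt0.
  apply: le_trans (norm_le_enorm _) _; apply: le_trans (fl _ _ Xx Xy) _.
  by rewrite -mulrA ler_wpM2l ?(ltW l0) // enorm_le_norm.
exists (m.+1%:R * l); split=> [|x y Xx Xy]; first by rewrite mulr_gt0.
apply: le_trans (enorm_le_norm _) _; rewrite -mulrA ler_wpM2l //.
apply: le_trans (fl _ _ Xx Xy) _.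
by rewrite ler_wpM2l ?(ltW l0) // norm_le_enorm.
Qed.

End EuclideanNorm.

(** * The cone over the trefoil as a parametric Lipschitz manifold *)

Section TrefoilCone.
Variable R : realType.
Local Notation C := R[i].
Local Notation Re := complex.Re.
Local Notation Im := complex.Im.

Lemma norm_Re_le (z : C) : `|Re z| <= normc z.
Proof. by case: z => a b /=; rewrite -sqrtr_sqr ler_wsqrtr // lerDl sqr_ge0. Qed.

Lemma norm_Im_le (z : C) : `|Im z| <= normc z.
Proof. by case: z => a b /=; rewrite -sqrtr_sqr ler_wsqrtr // lerDr sqr_ge0. Qed.

Lemma normc_le (z : C) (a : R) : `|Re z| <= a -> `|Im z| <= a -> normc z <= 2 * a.
Proof.
case: z => x y xa ya; have {}xa : `|x| <= a := xa; have {}ya : `|y| <= a := ya.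
have -> : x +i* y = x%:C + 'i * y%:C.
  by apply/eqP; rewrite eq_complex /=; apply/andP; split; apply/eqP; ring.
apply: le_trans (normcD _ _) _; rewrite normcM !normc_real.
have -> : normc ('i : C) = 1 by rewrite /normc expr0n expr1n add0r sqrtr1.
lra.
Qed.

Definition coordC n (i j : 'I_n) (x : 'rV[R]_n) : C := x 0 i +i* x 0 j.

Lemma coordC_lipschitz n (i j : 'I_n) (x y : 'rV[R]_n) :
  normc (coordC i j x - coordC i j y) <= 2 * `|x - y|.
Proof.
apply: normc_le => /=.
  by have := rV_coord_le (x - y) i; rewrite !mxE.
by have := rV_coord_le (x - y) j; rewrite !mxE.
Qed.

Lemma coordC_le n (i j : 'I_n) (x : 'rV[R]_n) : normc (coordC i j x) <= 2 * `|x|.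
Proof.
have := coordC_lipschitz i j x 0; rewrite subr0; congr (normc _ <= _).
rewrite /coordC !mxE; apply/eqP; rewrite eq_complex /= !subr0 !eqxx //.
Qed.

Lemma coordCB n (i j : 'I_n) (x y : 'rV[R]_n) :
  coordC i j x - coordC i j y = coordC i j (x - y).
Proof. by apply/eqP; rewrite eq_complex /= !mxE !eqxx. Qed.

Definition row_seq n (s : seq R) : 'rV[R]_n := \row_(i < n) s`_i.

Local Notation i20 := (Ordinal (isT : (0 < 2)%N)).
Local Notation i21 := (Ordinal (isT : (1 < 2)%N)).
Local Notation i40 := (Ordinal (isT : (0 < 4)%N)).
Local Notation i41 := (Ordinal (isT : (1 < 4)%N)).
Local Notation i42 := (Ordinal (isT : (2 < 4)%N)).
Local Notation i43 := (Ordinal (isT : (3 < 4)%N)).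

Definition tC : 'rV[R]_2 -> C := coordC i20 i21.
Definition zC : 'rV[R]_4 -> C := coordC i40 i41.
Definition wC : 'rV[R]_4 -> C := coordC i42 i43.
Definition of_tC (t : C) : 'rV[R]_2 := row_seq 2 [:: Re t; Im t].
Definition of_zwC (z w : C) : 'rV[R]_4 := row_seq 4 [:: Re z; Im z; Re w; Im w].

Lemma tCB x y : tC (x - y) = tC x - tC y. Proof. by rewrite /tC coordCB. Qed.
Lemma zCB x y : zC (x - y) = zC x - zC y. Proof. by rewrite /zC coordCB. Qed.
Lemma wCB x y : wC (x - y) = wC x - wC y. Proof. by rewrite /wC coordCB. Qed.

Lemma tC_lipschitz x y : normc (tC x - tC y) <= 2 * `|x - y|.
Proof. exact: coordC_lipschitz. Qed.
Lemma zC_lipschitz x y : normc (zC x - zC y) <= 2 * `|x - y|.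
Proof. exact: coordC_lipschitz. Qed.
Lemma wC_lipschitz x y : normc (wC x - wC y) <= 2 * `|x - y|.
Proof. exact: coordC_lipschitz. Qed.

Lemma of_tCK t : tC (of_tC t) = t.
Proof. by case: t => a b; rewrite /tC /coordC !mxE. Qed.

Lemma tCK : cancel tC of_tC.
Proof.
move=> x; apply/rowP => i; rewrite mxE.
by case: i => [[|[|//]] ?]; congr (x _ _); apply/val_inj.
Qed.

Lemma zC_of z w : zC (of_zwC z w) = z.
Proof. by case: z => a b; rewrite /zC /coordC !mxE. Qed.

Lemma wC_of z w : wC (of_zwC z w) = w.
Proof. by case: w => a b; rewrite /wC /coordC !mxE. Qed.

Lemma of_zwCK x : of_zwC (zC x) (wC x) = x.
Proof.
apply/rowP => i; rewrite mxE.
by case: i => [[|[|[|[|//]]]] ?]; congr (x _ _); apply/val_inj.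
Qed.

Lemma norm_tC_le x : `|x| <= normc (tC x).
Proof.
apply: rV_norm_le; first exact: normc_ge0.
move=> i; rewrite -{1}(tCK x) mxE.
by case: i => [[|[|//]] ?]; [exact: (norm_Re_le (tC x))|exact: (norm_Im_le (tC x))].
Qed.

Lemma norm_zwC_le x a : normc (zC x) <= a -> normc (wC x) <= a -> `|x| <= a.
Proof.
move=> za wa; apply: rV_norm_le; first exact: le_trans (normc_ge0 _) za.
move=> i; rewrite -{1}(of_zwCK x) mxE.
case: i => [[|[|[|[|//]]]] ?].
- by apply: le_trans za; exact: (norm_Re_le (zC x)).
- by apply: le_trans za; exact: (norm_Im_le (zC x)).
- by apply: le_trans wa; exact: (norm_Re_le (wC x)).
- by apply: le_trans wa; exact: (norm_Im_le (wC x)).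
Qed.

Definition trefoil_param (x : 'rV[R]_2) : 'rV[R]_4 :=
  of_zwC (tC x * dirc (tC x) ^+ 2) (tC x * dirc (tC x)).

Definition trefoil_cone : set 'rV[R]_4 := range trefoil_param.

Definition trefoil_coparam (x : 'rV[R]_4) : 'rV[R]_2 :=
  of_tC (zC x * (dirc (wC x))^*).

Lemma trefoil_paramK : cancel trefoil_param trefoil_coparam.
Proof.
by move=> x; rewrite /trefoil_coparam zC_of wC_of cone_inv tCK.
Qed.

Lemma trefoil_param_lipschitz x y :
  `|trefoil_param x - trefoil_param y| <= 10 * `|x - y|.
Proof.
have h := tC_lipschitz x y.
apply: norm_zwC_le; rewrite ?zCB ?wCB !(zC_of, wC_of).
  by have := mul_dirc2_lipschitz (tC y) (tC x); lra.
have := mul_dirc_lipschitz (tC y) (tC x); have := normr_ge0 (x - y); lra.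
Qed.

Lemma trefoil_coparam_lipschitz x y : trefoil_cone x -> trefoil_cone y ->
  `|trefoil_coparam x - trefoil_coparam y| <= 6 * `|x - y|.
Proof.
move=> _ [y' _ yE].
have zw : normc (zC y) = normc (wC y).
  by rewrite -yE zC_of wC_of mul_dirc2_norm mul_dirc_norm.
apply: le_trans (norm_tC_le _) _; rewrite tCB !of_tCK.
apply: le_trans (conj_dirc_lipschitz (zC x) (wC x) zw) _.
have := zC_lipschitz x y; have := wC_lipschitz x y; lra.
Qed.

Lemma trefoil_cone_norm x : trefoil_cone x -> normc (zC x) = normc (wC x).
Proof. by move=> [y _ <-]; rewrite zC_of wC_of mul_dirc2_norm mul_dirc_norm. Qed.

Lemma trefoil_cone0 : trefoil_cone 0.
Proof.
exists (of_tC 0) => //; rewrite /trefoil_param of_tCK !mul0r.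
by apply/rowP => -[[|[|[|[|//]]]] ?]; rewrite !mxE.
Qed.

(** Consequently the discriminant of the cubic does not vanish off the cone. *)
Lemma trefoil_coneP x :
  (wC x * (normc (wC x))%:C) ^+ 3 = (zC x * ((normc (zC x)) ^+ 2)%:C) ^+ 2 ->
  trefoil_cone x.
Proof.
move=> /cone_of_cusp [t [zt wt]]; exists (of_tC t) => //.
by rewrite /trefoil_param of_tCK -zt -wt of_zwCK.
Qed.

Lemma trefoil_cone_parametric : parametric_lipschitz_manifold 2 trefoil_cone.
Proof.
move=> x0 _; exists setT, setT, trefoil_param; split; [exact: openT|by []|exact: openT|].
rewrite setIT; split.
- by move=> x _; exists x.
- apply/is_lipschitzP; exists 10; split=> // x y _ _.
  exact: trefoil_param_lipschitz.
exists trefoil_coparam; split=> //.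
- by move=> x _; exact: trefoil_paramK.
- by move=> x; rewrite inE => -[y _ <-]; rewrite trefoil_paramK.
apply/is_lipschitzP; exists 6; split=> //; exact: trefoil_coparam_lipschitz.
Qed.

End TrefoilCone.

(** * Charts at the vertex, and the exclusion of dimensions other than 2 *)

Section Charts.
Variable R : realType.

(** The inverse chart is replaced by a McShane extension [psi], Lipschitz on the whole space, and
    invariance of domain gives a full ball on which [psi] inverts [phi]. *)
Lemma flat_chart n l (M : set 'rV[R]_n.+1) : lipschitz_submanifold l M -> M 0 ->
  exists (phi psi : 'rV[R]_n.+1 -> 'rV[R]_n.+1) (r L eps : R),
  [/\ [/\ 0 < r, 0 < L, 0 < eps & phi 0 = 0],
      forall y y', `|psi y - psi y'| <= L * `|y - y'|,
      forall x, `|x| <= r -> psi (phi x) = x /\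
        (M x <-> forall i : 'I_n.+1, (l <= i)%N -> phi x 0 i = 0),
      forall x x', `|x| <= r -> `|x'| <= r ->
        `|phi x - phi x'| <= L * `|x - x'| &
      forall y, `|y| <= eps -> `|psi y| <= r /\ phi (psi y) = y].
Proof.
move=> flat M0.
have [U [phi [oU U0 [_ phiL [psi [psiU phiK psiK psiL]]] phiM phi0]]] := flat 0 M0.
have [l1 [l10 {}phiL]] := (is_lipschitzP _ _).1 phiL.
have [l2 [l20 {}psiL]] := (is_lipschitzP _ _).1 psiL.
have /nbhs_ballP[d /= d0 dU] := open_nbhs_nbhs (conj oU U0).
pose r := d / 2; have r0 : 0 < r by rewrite divr_gt0.
have rU x : `|x| <= r -> U x.
  by move=> xr; apply: dU; rewrite -ball_normE /= sub0r normrN; rewrite /r in xr; lra.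
pose L := l1 + l2; have L0 : 0 < L by rewrite addr_gt0.
have phiL' x x' : `|x| <= r -> `|x'| <= r -> `|phi x - phi x'| <= L * `|x - x'|.
  move=> /rU Ux /rU Ux'; apply: le_trans (phiL _ _ Ux Ux') _.
  by rewrite ler_wpM2r // lerDl ltW.
have phiU x : U x -> (phi @` U) (phi x) by move=> Ux; exists x.
have phiK' x : U x -> psi (phi x) = x by move=> Ux; apply: phiK; rewrite inE.
have psiL' x x' : `|x| <= r -> `|x'| <= r -> `|x - x'| <= L * `|phi x - phi x'|.
  move=> /rU Ux /rU Ux'.
  have := psiL _ _ (phiU _ Ux) (phiU _ Ux'); rewrite !phiK' // => /le_trans; apply.
  by rewrite ler_wpM2r // lerDr ltW.
have [e [e0 He]] := bilipschitz_open r0 L0 (fun x x' xr xr' => conj (phiL' x x' xr xr') (psiL' x x' xr xr')).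
have [G [GE GL]] : exists G : 'rV[R]_n.+1 -> 'rV[R]_n.+1,
    (forall x, `|x| <= r -> G (phi x) = x) /\ forall y y', `|G y - G y'| <= L * `|y - y'|.
  apply: (@mcshane_rV _ _ [set x | `|x| <= r] _ id _ phi L) => //; first exact: ltW.
  by exists 0; rewrite /= normr0 ltW.
exists phi, G, r, L, (e / 2); split=> //.
- by split=> //; rewrite divr_gt0.
- move=> x xr; split; first exact: GE.
  have Ux := rU _ xr; split=> [Mx i li|xl].
    have : (phi @` (M `&` U)) (phi x) by exists x.
    by rewrite phiM => -[_]; apply.
  have : (phi @` (M `&` U)) (phi x) by rewrite phiM; split=> //; exact: phiU.
  by move=> [x' [Mx' Ux'] xx]; rewrite -(phiK' _ Ux) -xx phiK'.
move=> y ye; have [|x [xr <-]] := He y; first by rewrite phi0 subr0; lra.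
by rewrite GE.
Qed.

(** By [bilipschitz_open] the image contains a point obtained from [f 0] by a shift along the [i]-th
    axis. *)
Lemma bilipschitz_not_flat n (f : 'rV[R]_n.+1 -> 'rV[R]_n.+1) (i : 'I_n.+1) (r L : R) :
  0 < r -> 0 < L ->
  (forall x x', `|x| <= r -> `|x'| <= r ->
     `|f x - f x'| <= L * `|x - x'| /\ `|x - x'| <= L * `|f x - f x'|) ->
  (forall x, `|x| <= r -> f x 0 i = 0) -> False.
Proof.
move=> r0 L0 fL fi.
have [e [e0 He]] := bilipschitz_open r0 L0 fL.
have ce : `|(e / 2) *: delta_mx 0 i : 'rV[R]_n.+1| < e.
  apply: (@le_lt_trans _ _ (e / 2)); last by lra.
  apply: rV_norm_le => [|j]; first by lra.
  rewrite !mxE eqxx /=; case: (j == i); rewrite ?mulr1 ?mulr0 ?normr0 ?gtr0_norm //; lra.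
have [|x [xr fx]] := He (f 0 + (e / 2) *: delta_mx 0 i).
  by rewrite addrAC subrr add0r.
have := fi x xr; rewrite fx !mxE !eqxx /= fi ?normr0 ?ltW // add0r mulr1; lra.
Qed.

Local Notation M := (@trefoil_cone R).

Lemma rV_subE n (x y : 'rV[R]_n) i : (x - y) 0 i = x 0 i - y 0 i.
Proof. by rewrite !mxE. Qed.

Lemma trefoil_param0 : trefoil_param (0 : 'rV[R]_2) = 0.
Proof.
have t0 : tC (0 : 'rV[R]_2) = 0 by rewrite -(subrr 0) tCB subrr.
rewrite /trefoil_param t0 !mul0r.
by apply/rowP => -[[|[|[|[|//]]]] ?]; rewrite !mxE.
Qed.

Lemma trefoil_coparamK : {in M, cancel (@trefoil_coparam R) (@trefoil_param R)}.
Proof. by move=> x; rewrite inE => -[y _ <-]; rewrite trefoil_paramK. Qed.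

(** The parametrization followed by the chart would embed a disc of the plane in a line; padding the
    line by a zero coordinate gives a flat bi-Lipschitz map of the plane. *)
Lemma trefoil_cone_not_thin l : (l < 2)%N -> ~ lipschitz_submanifold l M.
Proof.
move=> l2 /flat_chart/(_ (trefoil_cone0 R)) [phi [psi [r [L [eps [[r0 L0 eps0 phi0] psiL phiM phiL _]]]]]].
pose F := @trefoil_param R.
have Fr x : `|x| <= r / 10 -> `|F x| <= r.
  by move=> xr; have := trefoil_param_lipschitz x 0; rewrite trefoil_param0 !subr0 /F; lra.
have FM x : M (F x) by exists x.
have phiF0 x (i : 'I_4) : `|x| <= r / 10 -> (1 <= i)%N -> phi (F x) 0 i = 0.
  move=> /Fr xr i1; have [_ /proj1/(_ (FM x)) h] := phiM _ xr.
  by apply: h; apply: leq_trans i1.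
pose f (x : 'rV[R]_2) : 'rV[R]_2 := row_seq 2 [:: phi (F x) 0 ord0].
have fE x x' : `|x| <= r / 10 -> `|x'| <= r / 10 -> `|f x - f x'| = `|phi (F x) - phi (F x')|.
  move=> xr xr'; apply/eqP; rewrite eq_le; apply/andP; split; apply: rV_norm_le => // i; rewrite !mxE.
    case: i => [[|[|//]] ?]; last by rewrite subrr normr0.
    by have := rV_coord_le (phi (F x) - phi (F x')) ord0; rewrite !mxE.
  have [i0|i0] := posnP i; last by rewrite !phiF0 // subrr normr0.
  have -> : i = ord0 by apply/val_inj.
  by have := rV_coord_le (f x - f x') ord0; rewrite !mxE.
apply: (@bilipschitz_not_flat _ f ord_max (r / 10) (10 * L)).
- by rewrite divr_gt0.
- by rewrite mulr_gt0.
- move=> x x' xr xr'; rewrite fE //; split.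
    apply: le_trans (phiL _ _ (Fr _ xr) (Fr _ xr')) _.
    by rewrite -mulrA mulrCA ler_pM2l // trefoil_param_lipschitz.
  have := trefoil_coparam_lipschitz (FM x) (FM x'); rewrite !trefoil_paramK => /le_trans; apply.
  have [<- _] := phiM _ (Fr _ xr); have [E' _] := phiM _ (Fr _ xr').
  have := psiL (phi (F x)) (phi (F x')); rewrite E' (phiM _ (Fr _ xr)).1 -/F.
  have := normr_ge0 (F x - F x'); lra.
by move=> x xr; rewrite mxE.
Qed.

(** Here the inverse chart followed by [trefoil_coparam] would embed a ball of 3-space in the plane,
    again padded by zero. The default 0 of [oapp] does the padding, both in [e4] and in [f]. *)
Lemma trefoil_cone_not_thick l : (2 < l)%N -> ~ lipschitz_submanifold l M.
Proof.
move=> l2 /flat_chart/(_ (trefoil_cone0 R)) [phi [psi [r [L [eps [[r0 L0 eps0 phi0] psiL phiM phiL phipsi]]]]]].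
pose e4 (y : 'rV[R]_3) : 'rV[R]_4 := \row_(i < 4) oapp (y 0) 0 (insub (i : nat)).
have e4E x y (i : 'I_4) : (e4 x - e4 y) 0 i = oapp ((x - y) 0) 0 (insub (i : nat)).
  by rewrite !mxE; case: insub => [j|] /=; rewrite ?subrr ?mxE.
have e4_norm x y : `|e4 x - e4 y| = `|x - y|.
  apply/eqP; rewrite eq_le; apply/andP; split; apply: rV_norm_le => // i.
    by rewrite e4E; case: insub => [j|] /=; rewrite ?normr0 // rV_coord_le.
  have := rV_coord_le (e4 x - e4 y) (widen_ord (isT : (3 <= 4)%N) i).
  by rewrite e4E (_ : insub _ = Some i) //; exact: valK.
have e40 : e4 0 = 0.
  by apply/rowP => i; rewrite !mxE; case: insub => [j|] //=; rewrite mxE.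
have psiM y : `|y| <= eps -> [/\ M (psi (e4 y)), `|psi (e4 y)| <= r & phi (psi (e4 y)) = e4 y].
  move=> ye; have ye4 : `|e4 y| <= eps by rewrite -(subr0 (e4 y)) -e40 e4_norm subr0.
  have [pr pE] := phipsi _ ye4; split=> //.
  apply/(phiM _ pr).2 => i li; rewrite pE mxE insubF //.
  by apply/negbTE; rewrite -leqNgt (leq_trans l2).
pose g y := trefoil_coparam (psi (e4 y)).
pose f (y : 'rV[R]_3) : 'rV[R]_3 := \row_(i < 3) oapp (g y 0) 0 (insub (i : nat)).
have fg x y : `|f x - f y| = `|g x - g y|.
  apply/eqP; rewrite eq_le; apply/andP; split; apply: rV_norm_le => // i.
    rewrite !mxE; case: insub => [j|] /=; last by rewrite subrr normr0.
    by have := rV_coord_le (g x - g y) j; rewrite !mxE.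
  have fE z : f z 0 (widen_ord (isT : (2 <= 3)%N) i) = g z 0 i.
    by rewrite mxE (_ : insub _ = Some i) //; exact: valK.
  have := rV_coord_le (f x - f y) (widen_ord (isT : (2 <= 3)%N) i).
  by rewrite rV_subE !fE -rV_subE.
apply: (@bilipschitz_not_flat _ f ord_max eps (10 * L)) => //.
- by rewrite mulr_gt0.
- move=> x x' xe xe'; rewrite fg.
  have [Mx xr xE] := psiM _ xe; have [Mx' xr' xE'] := psiM _ xe'; split.
    apply: le_trans (trefoil_coparam_lipschitz Mx Mx') _.
    have := psiL (e4 x) (e4 x'); rewrite e4_norm.
    have := mulr_ge0 (ltW L0) (normr_ge0 (x - x')); lra.
  rewrite -e4_norm -xE -xE'; apply: le_trans (phiL _ _ xr xr') _.
  rewrite -mulrA mulrCA ler_pM2l //.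
  have := trefoil_param_lipschitz (g x) (g x').
  by rewrite !trefoil_coparamK ?inE.
by move=> x xr; rewrite mxE insubF.
Qed.

End Charts.

(** * Continuation of roots over convex sets *)

Section Selections.
Variables (R : realType) (V : normedModType R).
Local Notation C := R[i].
Implicit Types (K : set V) (f g : V -> C) (y : V).

Definition seg_convex K := forall x y (t : R), K x -> K y -> 0 <= t <= 1 ->
  K (x + t *: (y - x)).

Definition unif_cont K f := forall e : R, 0 < e -> exists d, 0 < d /\
  forall y y', K y -> K y' -> `|y - y'| < d -> normc (f y - f y') < e.

(** The segment from [x] to [y] is cut into pieces shorter than [d]. *)
Lemma locally_constant K (P : V -> Prop) (d : R) x y : seg_convex K -> 0 < d ->
  (forall y y', K y -> K y' -> `|y - y'| < d -> P y -> P y') ->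
  K x -> K y -> P x -> P y.
Proof.
move=> cK d0 Pd Kx Ky Px.
pose N := (Num.bound (`|y - x| / d)).+1.
have N0 : 0 < N%:R :> R by rewrite ltr0n.
have Nd : `|y - x| / N%:R < d.
  rewrite ltr_pdivrMr // mulrC -ltr_pdivrMr //.
  apply: lt_le_trans (archi_boundP _) _; first by rewrite divr_ge0 // ltW.
  by rewrite ler_nat.
have step j : (j <= N)%N -> K (x + (j%:R / N%:R) *: (y - x)).
  move=> jN; apply: cK => //; rewrite divr_ge0 //= ler_pdivrMr // mul1r ler_nat //.
have Pj j : (j <= N)%N -> P (x + (j%:R / N%:R) *: (y - x)).
  elim: j => [|j IH] jN; first by rewrite mul0r scale0r addr0.
  apply: (Pd _ _ (step _ (ltnW jN)) (step _ jN) _ (IH (ltnW jN))).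
  rewrite opprD addrACA subrr add0r -scalerBl -mulrBl -natr1 opprD addrA subrr add0r.
  by rewrite mulN1r scaleNr normrN normrZ ger0_norm ?invr_ge0 // mulrC.
by have := Pj N (leqnn N); rewrite divff ?gt_eqF // scale1r addrC subrK.
Qed.

Section RootFamily.
Variables (K : set V) (Rt : V -> C -> Prop) (s : R).
Hypothesis cK : seg_convex K.
Hypothesis s0 : 0 < s.
(** Together [sep] and [pert] express, with uniform constants, that the roots form a covering of
    [K]. *)
Hypothesis sep : forall y x x', K y -> Rt y x -> Rt y x' ->
  normc (x - x') < s -> x = x'.
Hypothesis pert : forall e : R, 0 < e -> exists d, 0 < d /\
  forall y y' x, K y -> K y' -> `|y - y'| < d -> Rt y x ->
  exists x', Rt y' x' /\ normc (x - x') < e.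

Lemma selection_unique f g c y : unif_cont K f -> unif_cont K g ->
  (forall y, K y -> Rt y (f y)) -> (forall y, K y -> Rt y (g y)) ->
  K c -> f c = g c -> K y -> f y = g y.
Proof.
move=> uf ug Rf Rg Kc fgc Ky.
have s2 : 0 < s / 2 by rewrite divr_gt0.
have [d1 [d10 H1]] := uf _ s2; have [d2 [d20 H2]] := ug _ s2.
apply: (@locally_constant K (fun y => f y = g y) (Num.min d1 d2) c y) => //.
  by rewrite lt_min d10.
move=> x x' Kx Kx'; rewrite lt_min => /andP[xd1 xd2] fgx.
apply: (sep Kx') => //; [exact: Rf|exact: Rg|].
have := H1 _ _ Kx Kx' xd1; have := H2 _ _ Kx Kx' xd2.
have := normc_tri (f x') (f x) (g x'); rewrite (normcC (f x') (f x)) fgx; lra.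
Qed.

Let step (y : V) (x : C) : C :=
  xget x [set x' | Rt y x' /\ normc (x - x') < s / 8].

(* The selection is continued along the segment from [c] to [y] by passing [N]
   times to the nearest root. *)
Let trans (c : V) (x0 : C) (N : nat) :=
  fix trans (j : nat) (y : V) : C :=
    if j is j'.+1 then step (c + (j%:R / N%:R) *: (y - c)) (trans j' y) else x0.

(** The bound [D] lets one [N] serve all of [K]: every step is shorter than the [d] that [pert]
    grants for [s / 8]. *)
Lemma selection_exists c x0 (D : R) : K c -> Rt c x0 ->
  (forall y, K y -> `|y - c| <= D) ->
  exists f, [/\ unif_cont K f, forall y, K y -> Rt y (f y) & f c = x0].
Proof.
move=> Kc Rc KD.
have s8 : 0 < s / 8 by rewrite divr_gt0.
have [d [d0 Hd]] := pert s8.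
have D0 : 0 <= D by have := KD c Kc; rewrite subrr normr0.
pose N := (Num.bound (D / d)).+1.
have N0 : 0 < N%:R :> R by rewrite ltr0n.
have Nd : D / N%:R < d.
  rewrite ltr_pdivrMr // mulrC -ltr_pdivrMr //.
  apply: lt_le_trans (archi_boundP _) _; first by rewrite divr_ge0 // ltW.
  by rewrite ler_nat.
pose pt j y := c + (j%:R / N%:R) *: (y - c).
have Kpt j y : (j <= N)%N -> K y -> K (pt j y).
  move=> jN Ky; apply: cK => //; rewrite divr_ge0 //= ler_pdivrMr // mul1r ler_nat //.
have ptd j y : K y -> `|pt j y - pt j.+1 y| < d.
  move=> Ky; apply: le_lt_trans Nd.
  rewrite /pt opprD addrACA subrr add0r -scalerBl -mulrBl -natr1 opprD addrA subrr add0r.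
  rewrite mulN1r scaleNr normrN normrZ ger0_norm ?invr_ge0 // mulrC.
  by rewrite ler_wpM2r ?invr_ge0 // KD.
have ptdd j y y' : (j <= N)%N -> `|pt j y - pt j y'| <= `|y - y'|.
  move=> jN; rewrite /pt opprD addrACA subrr add0r -scalerBr.
  rewrite opprB addrA subrK normrZ ger0_norm ?divr_ge0 //.
  by rewrite ler_piMl // ler_pdivrMr // mul1r ler_nat.
pose T := trans c x0 N.
have TS j y : (j < N)%N -> K y -> Rt (pt j y) (T j y) ->
    Rt (pt j.+1 y) (T j.+1 y) /\ normc (T j y - T j.+1 y) < s / 8.
  move=> jN Ky Rj.
  have [x' hx'] := Hd _ _ _ (Kpt _ _ (ltnW jN) Ky) (Kpt _ _ jN Ky) (ptd j y Ky) Rj.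
  by rewrite /T /= -/(T j y); exact: (@xgetPex _ (T j y)
    [set x' | Rt (pt j.+1 y) x' /\ normc (T j y - x') < s / 8]) (ex_intro _ _ hx').
have TR j y : (j <= N)%N -> K y -> Rt (pt j y) (T j y).
  move=> + Ky; elim: j => [|j IH] jN; first by rewrite /pt mul0r scale0r addr0.
  by case: (TS j y jN Ky (IH (ltnW jN))).
have ptN y : pt N y = y by rewrite /pt divff ?gt_eqF // scale1r addrC subrK.
have ptc j : pt j c = c by rewrite /pt subrr scaler0 addr0.
exists (T N); split.
- move=> e e0.
  (* The error does not accumulate along the segments: the root over [y'] close to [T j.+1 y] turns
     out to be [T j.+1 y'] itself, so each step restores the bound [e']. *)
  pose e' := Num.min e (s / 8).
  have e'0 : 0 < e' by rewrite lt_min e0.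
  have e's : e' <= s / 8 by rewrite ge_min lexx orbT.
  have [d' [d'0 Hd']] := pert e'0.
  exists d'; split=> // y y' Ky Ky' yy'.
  suff H j : (j <= N)%N -> normc (T j y - T j y') < e'.
    by apply: lt_le_trans (H N (leqnn N)) _; rewrite ge_min lexx.
  elim: j => [|j IH] jN; first by rewrite subrr normc0.
  have {}IH := IH (ltnW jN).
  have [_ h1] := TS j y jN Ky (TR _ _ (ltnW jN) Ky).
  have [_ h2] := TS j y' jN Ky' (TR _ _ (ltnW jN) Ky').
  have [x' [Rx' xx']] := Hd' _ _ _ (Kpt _ _ jN Ky) (Kpt _ _ jN Ky')
    (le_lt_trans (ptdd _ _ _ jN) yy') (TR _ _ jN Ky).
  (* The two roots are joined by four gaps, each below [s / 8], so [sep] identifies them. *)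
  suff <- : x' = T j.+1 y' by [].
  apply: (sep (Kpt _ _ jN Ky') Rx' (TR _ _ jN Ky')).
  have := normc_tri x' (T j.+1 y) (T j.+1 y'); rewrite (normcC x' (T j.+1 y)).
  have := normc_tri (T j.+1 y) (T j y) (T j.+1 y'); rewrite (normcC (T j.+1 y) (T j y)).
  have := normc_tri (T j y) (T j y') (T j.+1 y'); lra.
- by move=> y Ky; have := TR N y (leqnn N) Ky; rewrite ptN.
suff H j : (j <= N)%N -> T j c = x0 by apply: H.
elim: j => [//|j IH] jN; have {}IH := IH (ltnW jN).
have [h1 h2] := TS j c jN Kc (TR _ _ (ltnW jN) Kc).
rewrite ptc in h1; apply: (sep Kc h1 Rc); rewrite IH normcC in h2.
by apply: lt_trans h2 _; lra.
Qed.

End RootFamily.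
End Selections.

(** * Algebra of uniformly continuous and of bounded Lipschitz functions *)

Section UniformContinuity.
Variables (R : realType) (V : normedModType R).
Local Notation C := R[i].
Implicit Types (K : set V) (f g : V -> C).

Lemma unif_contB K f g : unif_cont K f -> unif_cont K g ->
  unif_cont K (fun y => f y - g y).
Proof.
move=> uf ug e e0; have e2 : 0 < e / 2 by rewrite divr_gt0.
have [d1 [d10 H1]] := uf _ e2; have [d2 [d20 H2]] := ug _ e2.
exists (Num.min d1 d2); split; first by rewrite lt_min d10.
move=> y y' Ky Ky'; rewrite lt_min => /andP[/(H1 _ _ Ky Ky') h1 /(H2 _ _ Ky Ky') h2].
have -> : f y - g y - (f y' - g y') = (f y - f y') - (g y - g y') by ring.
apply: le_lt_trans (normcB _ _) _; lra.
Qed.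

Lemma unif_contM K f g (B : R) : unif_cont K f -> unif_cont K g ->
  (forall y, K y -> normc (f y) <= B) -> (forall y, K y -> normc (g y) <= B) ->
  unif_cont K (fun y => f y * g y).
Proof.
move=> uf ug fB gB e e0; pose b := `|B| + 1.
have b0 : 0 < b by rewrite ltr_wpDl.
have Bb : B <= b by apply: le_trans (ler_norm B) _; rewrite lerDl.
have e2 : 0 < e / (2 * b) by rewrite divr_gt0 // mulr_gt0.
have [d1 [d10 H1]] := uf _ e2; have [d2 [d20 H2]] := ug _ e2.
exists (Num.min d1 d2); split; first by rewrite lt_min d10.
move=> y y' Ky Ky'; rewrite lt_min => /andP[/(H1 _ _ Ky Ky') h1 /(H2 _ _ Ky Ky') h2].
have -> : f y * g y - f y' * g y' = (f y - f y') * g y + f y' * (g y - g y') by ring.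
apply: le_lt_trans (normcD _ _) _; rewrite (normcM (f y - _)) (normcM (f y')).
have -> : e = e / (2 * b) * b + b * (e / (2 * b)) by field; rewrite gt_eqF.
apply: ltr_leD.
  apply: le_lt_trans (_ : normc (f y - f y') * b < _).
    by rewrite ler_wpM2l ?normc_ge0 // (le_trans (gB _ Ky)).
  by rewrite ltr_pM2r.
apply: ler_pM; rewrite ?normc_ge0 ?(ltW h2) //.
exact: le_trans (fB _ Ky') Bb.
Qed.

Definition lip_bounded K f := exists b : R, [/\ 0 <= b,
  forall y, K y -> normc (f y) <= b &
  forall y y', K y -> K y' -> normc (f y - f y') <= b * `|y - y'|].

Lemma lip_boundedM K f g : lip_bounded K f -> lip_bounded K g ->
  lip_bounded K (fun y => f y * g y).
Proof.
move=> [a [a0 fa fl]] [b [b0 gb gl]]; exists (2 * a * b + a * b); split.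
- by rewrite addr_ge0 // !mulr_ge0.
- move=> y Ky; rewrite normcM; apply: le_trans (_ : a * b <= _).
    by apply: ler_pM; rewrite ?normc_ge0 ?fa ?gb.
  by rewrite lerDr !mulr_ge0.
move=> y y' Ky Ky'.
have -> : f y * g y - f y' * g y' = (f y - f y') * g y + f y' * (g y - g y') by ring.
apply: le_trans (normcD _ _) _; rewrite (normcM (f y - _)) (normcM (f y')).
have h1 : normc (f y - f y') * normc (g y) <= (a * `|y - y'|) * b.
  by apply: ler_pM; rewrite ?normc_ge0 ?fl ?gb.
have h2 : normc (f y') * normc (g y - g y') <= a * (b * `|y - y'|).
  by apply: ler_pM; rewrite ?normc_ge0 ?gl ?fa.
have h3 : 0 <= a * b * `|y - y'| by rewrite !mulr_ge0.
lra.
Qed.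

Lemma lip_boundedB K f g : lip_bounded K f -> lip_bounded K g ->
  lip_bounded K (fun y => f y - g y).
Proof.
move=> [a [a0 fa fl]] [b [b0 gb gl]]; exists (a + b); split.
- exact: addr_ge0.
- by move=> y Ky; apply: le_trans (normcB _ _) _; apply: lerD; [exact: fa|exact: gb].
move=> y y' Ky Ky'.
have -> : f y - g y - (f y' - g y') = (f y - f y') - (g y - g y') by ring.
apply: le_trans (normcB _ _) _.
have := fl _ _ Ky Ky'; have := gl _ _ Ky Ky'; lra.
Qed.

Lemma lip_bounded_norm K f : lip_bounded K f -> lip_bounded K (fun y => (normc (f y))%:C).
Proof.
move=> [a [a0 fa fl]]; exists a; split=> //.
- by move=> y Ky; rewrite normc_real ger0_norm ?normc_ge0 // fa.
move=> y y' Ky Ky'; have -> : (normc (f y))%:C - (normc (f y'))%:C = (normc (f y) - normc (f y'))%:C.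
  by rewrite rmorphB.
rewrite normc_real.
by apply: le_trans (normc_distD _ _) _; exact: fl.
Qed.

Lemma lip_boundedS K K' f : K' `<=` K -> lip_bounded K f -> lip_bounded K' f.
Proof.
move=> KK [a [a0 fa fl]]; exists a; split=> // [y /KK|y y' /KK Ky /KK]; [exact: fa|exact: fl].
Qed.

End UniformContinuity.

(** * Roots and discriminant of the cubic *)

Section Cubic.
Variable R : realType.
Local Notation C := R[i].
Implicit Types p q x : C.

Definition cubic_root p q x := x ^+ 3 - 3 * p * x + 2 * q = 0.

Lemma cubic_rootB p q x x' : cubic_root p q x -> cubic_root p q x' -> x != x' ->
  3 * p = x ^+ 2 + x * x' + x' ^+ 2 /\ 2 * q = x * x' * (x + x').
Proof.
move=> rx rx' xx'; have xx0 : x - x' != 0 by rewrite subr_eq0.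
have p3 : 3 * p = x ^+ 2 + x * x' + x' ^+ 2.
  apply: (mulfI xx0); apply/eqP; rewrite -subr_eq0; apply/eqP.
  transitivity ((x' ^+ 3 - 3 * p * x' + 2 * q) - (x ^+ 3 - 3 * p * x + 2 * q)); first by ring.
  by rewrite rx rx' subrr.
split=> //; apply/eqP; rewrite -subr_eq0; apply/eqP.
transitivity ((x ^+ 3 - 3 * p * x + 2 * q) + (3 * p - (x ^+ 2 + x * x' + x' ^+ 2)) * x); first by ring.
by rewrite rx p3 subrr mul0r addr0.
Qed.

(** The third root is [-(x + x')], so the right side is the squared product of the root differences.
    Written in two roots, it bounds their distance from below. *)
Lemma cubic_disc2 p q x x' : cubic_root p q x -> cubic_root p q x' -> x != x' ->
  108 * (p ^+ 3 - q ^+ 2) = (x - x') ^+ 2 * ((2 * x + x') * (x + 2 * x')) ^+ 2.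
Proof.
move=> rx rx' xx'; have [p3 q2] := cubic_rootB rx rx' xx'.
transitivity (4 * (3 * p) ^+ 3 - 27 * (2 * q) ^+ 2); first by ring.
rewrite p3 q2; ring.
Qed.

Lemma cubic_disc3 p q x1 x2 x3 : cubic_root p q x1 -> cubic_root p q x2 ->
  cubic_root p q x3 -> x1 != x2 -> x2 != x3 -> x3 != x1 ->
  108 * (p ^+ 3 - q ^+ 2) = ((x1 - x2) * (x2 - x3) * (x3 - x1)) ^+ 2.
Proof.
move=> r1 r2 r3 x12 x23 x31; rewrite (cubic_disc2 r1 r2 x12).
have [a _] := cubic_rootB r1 r2 x12; have [b _] := cubic_rootB r3 r1 x31.
have x32 : x3 - x2 != 0 by rewrite subr_eq0 eq_sym.
have -> : x3 = - (x1 + x2).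
  apply/eqP; rewrite -addr_eq0; apply/eqP; apply: (mulfI x32); rewrite mulr0.
  by apply/eqP; rewrite -(subrr (3 * p)) {1}b a; apply/eqP; ring.
ring.
Qed.

Lemma cubic_split p q : exists x1 x2 x3,
  forall x, x ^+ 3 - 3 * p * x + 2 * q = (x - x1) * (x - x2) * (x - x3).
Proof.
have [x1 Hx1] := @solve_monicpoly C 3 (nth 0 [:: - (2 * q); 3 * p]) isT.
rewrite !big_ord_recl big_ord0 /= in Hx1.
(* This is the discriminant of the quotient [x^2 + x1 x + x1^2 - 3 p]. *)
pose S := sqrtc (12 * p - 3 * x1 ^+ 2).
have S2 : S ^+ 2 = 12 * p - 3 * x1 ^+ 2 by rewrite sqr_sqrtc.
have two : (2 : C) != 0 by rewrite pnatr_eq0.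
exists x1, ((- x1 + S) / 2), ((- x1 - S) / 2) => x.
transitivity ((x - x1) * ((x + x1 / 2) ^+ 2 - S ^+ 2 / 4)); last by field.
rewrite S2; apply/eqP; rewrite -subr_eq0; apply/eqP.
transitivity (x1 ^+ 3 - 3 * p * x1 + 2 * q); first by field.
rewrite Hx1; rewrite /bump /=; ring.
Qed.

Lemma cubic_distinct_roots p q : p ^+ 3 != q ^+ 2 -> exists x1 x2 x3,
  [/\ cubic_root p q x1, cubic_root p q x2, cubic_root p q x3 &
   [/\ x1 != x2, x2 != x3, x3 != x1 &
     forall x, cubic_root p q x -> [\/ x = x1, x = x2 | x = x3]]].
Proof.
move=> pq; have [x1 [x2 [x3 H]]] := cubic_split p q.
have R1 : cubic_root p q x1 by rewrite /cubic_root H subrr !mul0r.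
have R2 : cubic_root p q x2 by rewrite /cubic_root H subrr mulr0 mul0r.
have R3 : cubic_root p q x3 by rewrite /cubic_root H subrr mulr0.
have q2 : 2 * q = - (x1 * x2 * x3).
  by have := H 0; rewrite expr0n /= mulr0 subrr add0r => ->; ring.
(* The values at 0, 1 and -1 suffice for Vieta's relations. *)
have h1 := H 1; have hm1 := H (-1).
have two : (2 : C) != 0 by rewrite pnatr_eq0.
have s0 : x1 + x2 + x3 = 0.
  apply: (mulfI two); rewrite mulr0.
  transitivity (- ((1 - x1) * (1 - x2) * (1 - x3) + (-1 - x1) * (-1 - x2) * (-1 - x3)) - 2 * (x1 * x2 * x3)); first by ring.
  rewrite -h1 -hm1; transitivity (- (2 * (2 * q)) - 2 * (x1 * x2 * x3)); first by ring.
  by rewrite q2; ring.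
have p3 : 3 * p = - (x1 * x2 + x2 * x3 + x3 * x1).
  apply: (mulfI two).
  transitivity (2 - (1 ^+ 3 - 3 * p * 1 + 2 * q) + ((-1) ^+ 3 - 3 * p * -1 + 2 * q)).
    by ring.
  by rewrite h1 hm1; ring.
have disc : 108 * (p ^+ 3 - q ^+ 2) = ((x1 - x2) * (x2 - x3) * (x3 - x1)) ^+ 2.
  transitivity (4 * (3 * p) ^+ 3 - 27 * (2 * q) ^+ 2); first by ring.
  rewrite p3 q2; have -> : x3 = - (x1 + x2) by apply/eqP; rewrite -addr_eq0 addrC s0.
  ring.
have : ((x1 - x2) * (x2 - x3) * (x3 - x1)) ^+ 2 != 0.
  by rewrite -disc mulf_neq0 ?pnatr_eq0 // subr_eq0.
rewrite expf_eq0 /= !mulf_eq0 !negb_or !subr_eq0 -andbA => /and3P[a b c].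
exists x1, x2, x3; split=> //; split=> // x; rewrite /cubic_root H => /eqP.
rewrite !mulf_eq0 !subr_eq0 -orbA => /or3P[] /eqP; [constructor 1|constructor 2|constructor 3]; done.
Qed.

Lemma cubic_root_le p q x (b : R) : cubic_root p q x ->
  normc p <= b -> normc q <= b -> normc x <= 1 + 5 * b.
Proof.
move=> rx pb qb; have b0 := le_trans (normc_ge0 p) pb.
have [x1|x1] := leP (normc x) 1; first by lra.
have E : x ^+ 3 = 3 * p * x - 2 * q.
  by apply/eqP; rewrite -subr_eq0 -rx; apply/eqP; ring.
have n2 n : normc (n%:R : C) = n%:R by rewrite -(rmorph_nat (real_complex R)) normc_real normr_nat.
have : normc x ^+ 3 <= 3 * b * normc x + 2 * b.
  rewrite -normcX E; apply: le_trans (normcB _ _) _.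
  rewrite (normcM (3 * p)) (normcM 3) (normcM 2) !n2; apply: lerD; last by lra.
  by rewrite ler_wpM2r ?normc_ge0 //; lra.
have := normc_ge0 x; move: (normc x) x1 => X x1 X0 H.
have : X ^+ 3 <= 5 * b * X by apply: le_trans H _; nra.
rewrite exprS (mulrC (5 * b)) ler_pM2l; last by lra.
by move=> h; nra.
Qed.

End Cubic.

(** * The three-sheeted covering and its monodromy *)

Section CubicCover.
Variables (R : realType) (V : normedModType R).
Local Notation C := R[i].
Implicit Types (K : set V) (p q f g : V -> C) (y : V).

Lemma cubic_sep K p q (c0 : R) : lip_bounded K p -> lip_bounded K q -> 0 < c0 ->
  (forall y, K y -> c0 <= normc (p y ^+ 3 - q y ^+ 2)) ->
  exists s, 0 < s /\ forall y x x', K y -> cubic_root (p y) (q y) x ->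
    cubic_root (p y) (q y) x' -> normc (x - x') < s -> x = x'.
Proof.
move=> [a [a0 pa _]] [b [b0 qb _]] c00 Hc.
pose r := 1 + 5 * (a + b).
have r1 : 1 <= r by rewrite lerDl mulr_ge0 // addr_ge0.
have r0 : 0 < r by apply: lt_le_trans r1.
(* All roots have modulus at most [r]. Distinct roots closer than [s] would give
   [108 * c0 <= s * (81 * r ^+ 4) <= 81 * c0] by [cubic_disc2]. *)
pose s := Num.min 1 (c0 / r ^+ 4).
have s0 : 0 < s by rewrite lt_min ltr01 divr_gt0 // exprn_gt0.
have s1 : s <= 1 by rewrite ge_min lexx.
have sc : s * r ^+ 4 <= c0.
  by rewrite -ler_pdivlMr ?exprn_gt0 // ge_min lexx orbT.
exists s; split=> // y x x' Ky rx rx' xs.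
apply/eqP; apply: contraT => xx'; exfalso.
have bound z : cubic_root (p y) (q y) z -> normc z <= r.
  move=> rz; apply: (cubic_root_le rz); first by apply: le_trans (pa _ Ky) _; rewrite lerDl.
  by apply: le_trans (qb _ Ky) _; rewrite lerDr.
have n2 n : normc (n%:R : C) = n%:R.
  by rewrite -(rmorph_nat (real_complex R)) normc_real normr_nat.
have := congr1 (@normc R) (cubic_disc2 rx rx' xx').
rewrite (normcM 108) n2 (normcM ((x - x') ^+ 2)) !normcX (normcM (2 * x + x')).
have h1 : normc (2 * x + x') <= 3 * r.
  apply: le_trans (normcD _ _) _; rewrite (normcM 2) n2.
  by have := bound _ rx; have := bound _ rx'; lra.
have h2 : normc (x + 2 * x') <= 3 * r.
  apply: le_trans (normcD _ _) _; rewrite (normcM 2) n2.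
  by have := bound _ rx; have := bound _ rx'; lra.
have h3 : normc (x - x') ^+ 2 <= s.
  have := normc_ge0 (x - x'); move: (normc (x - x')) xs => X xs X0; nra.
have h4 : (normc (2 * x + x') * normc (x + 2 * x')) ^+ 2 <= 81 * r ^+ 4.
  have -> : 81 * r ^+ 4 = ((3 * r) * (3 * r)) ^+ 2 by ring.
  rewrite ler_sqr ?nnegrE ?mulr_ge0 ?normc_ge0 ?(ltW r0) //.
  by apply: ler_pM; rewrite ?normc_ge0.
have h5 : normc (x - x') ^+ 2 * (normc (2 * x + x') * normc (x + 2 * x')) ^+ 2 <= s * (81 * r ^+ 4).
  by apply: ler_pM; rewrite ?sqr_ge0.
rewrite [s * _]mulrCA in h5; move: (Hc _ Ky) sc h5.
move: (s * r ^+ 4) (_ * (_ * _) ^+ 2) (normc (_ - q y ^+ 2)) => A1 A2 A3; lra.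
Qed.

(** The value of the new cubic at an old root is the product of its differences with the three new
    roots; if it is below [e ^+ 3] in modulus, some difference is below [e]. *)
Lemma cubic_pert K p q : lip_bounded K p -> lip_bounded K q ->
  forall e : R, 0 < e -> exists d, 0 < d /\
  forall y y' x, K y -> K y' -> `|y - y'| < d -> cubic_root (p y) (q y) x ->
  exists x', cubic_root (p y') (q y') x' /\ normc (x - x') < e.
Proof.
move=> [a [a0 pa pl]] [b [b0 qb ql]] e e0.
pose r := 1 + 5 * (a + b).
have r1 : 1 <= r by rewrite lerDl mulr_ge0 // addr_ge0.
pose A := 3 * a * r + 2 * b + 1.
have A0 : 0 < A.
  by have := mulr_ge0 a0 (le_trans ler01 r1); rewrite /A; lra.
exists (e ^+ 3 / A); split; first by rewrite divr_gt0 // exprn_gt0.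
move=> y y' x Ky Ky' yy rx.
have n2 n : normc (n%:R : C) = n%:R.
  by rewrite -(rmorph_nat (real_complex R)) normc_real normr_nat.
have xr : normc x <= r.
  apply: (cubic_root_le rx); first by apply: le_trans (pa _ Ky) _; rewrite lerDl.
  by apply: le_trans (qb _ Ky) _; rewrite lerDr.
have [x1 [x2 [x3 H]]] := cubic_split (p y') (q y').
have small : normc ((x - x1) * (x - x2) * (x - x3)) < e ^+ 3.
  rewrite -H.
  have -> : x ^+ 3 - 3 * p y' * x + 2 * q y' = 3 * (p y - p y') * x - 2 * (q y - q y').
    transitivity (3 * (p y - p y') * x - 2 * (q y - q y') + (x ^+ 3 - 3 * p y * x + 2 * q y)); first by ring.
    by rewrite rx addr0.
  apply: le_lt_trans (normcB _ _) _.
  rewrite (normcM (3 * _)) (normcM 3) (normcM 2) !n2.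
  have h1 : 3 * normc (p y - p y') * normc x <= 3 * (a * `|y - y'|) * r.
    by apply: ler_pM; rewrite ?mulr_ge0 ?normc_ge0 // ler_wpM2l // pl.
  have h2 := ql _ _ Ky Ky'.
  have h3 : A * `|y - y'| < e ^+ 3 by rewrite mulrC -ltr_pdivlMr.
  have h4 := normr_ge0 (y - y').
  rewrite /A in h3; lra.
have e3 : ~ [/\ e <= normc (x - x1), e <= normc (x - x2) & e <= normc (x - x3)].
  move=> [h1 h2 h3]; move: small; apply/negP; rewrite -leNgt.
  rewrite (normcM (_ * _)) (normcM (x - x1)) exprSr expr2.
  have eg := ltW e0.
  by apply: ler_pM => //; [rewrite mulr_ge0|apply: ler_pM].
have [l1|l1] := ltP (normc (x - x1)) e.
  by exists x1; split=> //; rewrite /cubic_root H subrr !mul0r.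
have [l2|l2] := ltP (normc (x - x2)) e.
  by exists x2; split=> //; rewrite /cubic_root H subrr mulr0 mul0r.
have [l3|l3] := ltP (normc (x - x3)) e.
  by exists x3; split=> //; rewrite /cubic_root H subrr mulr0.
by exfalso; apply: e3.
Qed.

Definition cubic_cover p q K := [/\ seg_convex K,
  exists D : R, forall y y', K y -> K y' -> `|y - y'| <= D,
  lip_bounded K p, lip_bounded K q &
  exists c0 : R, 0 < c0 /\ forall y, K y -> c0 <= normc (p y ^+ 3 - q y ^+ 2)].

Definition root_selection p q K f :=
  unif_cont K f /\ forall y, K y -> cubic_root (p y) (q y) (f y).

Lemma root_selectionS p q K K' f : K' `<=` K ->
  root_selection p q K f -> root_selection p q K' f.
Proof.
move=> KK [uf rf]; split=> [e /uf[d [d0 H]]|y /KK]; last exact: rf.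
by exists d; split=> // y y' /KK Ky /KK; exact: H.
Qed.

Lemma cubic_coverI p q K K' :
  cubic_cover p q K -> cubic_cover p q K' -> cubic_cover p q (K `&` K').
Proof.
move=> [cK [D HD] lp lq [c0 [c00 Hc]]] [cK' _ _ _ _]; split.
- by move=> x y t [Kx Kx'] [Ky Ky'] t01; split; [exact: cK|exact: cK'].
- by exists D => y y' [Ky _] [Ky' _]; exact: HD.
- by apply: lip_boundedS lp => y [].
- by apply: lip_boundedS lq => y [].
by exists c0; split=> // y [Ky _]; exact: Hc.
Qed.

Lemma root_selection_exists p q K c x0 : cubic_cover p q K -> K c ->
  cubic_root (p c) (q c) x0 -> exists f, root_selection p q K f /\ f c = x0.
Proof.
move=> [cK [D HD] lp lq [c0 [c00 Hc]]] Kc rc.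
have [s [s0 Hs]] := cubic_sep lp lq c00 Hc.
have [f [uf rf fc]] := selection_exists cK s0 Hs (cubic_pert lp lq) Kc rc (fun y Ky => HD y c Ky Kc).
by exists f.
Qed.

Lemma root_selection_unique p q K f g c y : cubic_cover p q K ->
  root_selection p q K f -> root_selection p q K g ->
  K c -> f c = g c -> K y -> f y = g y.
Proof.
move=> [cK [D HD] lp lq [c0 [c00 Hc]]] [uf rf] [ug rg].
have [s [s0 Hs]] := cubic_sep lp lq c00 Hc.
exact: (selection_unique cK s0 Hs).
Qed.

(** The constant [mu] is a Lebesgue number of the cover: points of [G] closer than [mu] share a
    piece. *)
Lemma unif_cont_glue K0 K1 K2 (G : set V) (h0 h1 h2 : V -> C) (mu : R) : 0 < mu ->
  (forall y y', G y -> G y' -> `|y - y'| < mu ->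
     [\/ K0 y /\ K0 y', K1 y /\ K1 y' | K2 y /\ K2 y']) ->
  unif_cont K0 h0 -> unif_cont K1 h1 -> unif_cont K2 h2 ->
  (forall y, K0 y -> K1 y -> h0 y = h1 y) ->
  (forall y, K1 y -> K2 y -> h1 y = h2 y) ->
  (forall y, K2 y -> K0 y -> h2 y = h0 y) ->
  exists g, [/\ unif_cont G g, forall y, K0 y -> g y = h0 y,
    forall y, K1 y -> g y = h1 y & forall y, K2 y -> g y = h2 y].
Proof.
move=> mu0 leb u0 u1 u2 a01 a12 a20.
pose g y := if pselect (K0 y) then h0 y else if pselect (K1 y) then h1 y else h2 y.
have g0 y : K0 y -> g y = h0 y by move=> k; rewrite /g; case: pselect.
have g1 y : K1 y -> g y = h1 y.
  by move=> k; rewrite /g; case: pselect => [k0|nk0]; [exact: a01|case: pselect].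
have g2 y : K2 y -> g y = h2 y.
  move=> k; rewrite /g; case: pselect => [k0|nk0]; first by rewrite a20.
  by case: pselect => [k1|//]; exact: a12.
exists g; split=> // e e0.
have [d0 [d00 H0]] := u0 _ e0; have [d1 [d10 H1]] := u1 _ e0; have [d2 [d20 H2]] := u2 _ e0.
exists (Num.min mu (Num.min d0 (Num.min d1 d2))); split; first by rewrite !lt_min mu0 d00 d10.
move=> y y' Gy Gy'; rewrite !lt_min => /and4P[ymu yd0 yd1 yd2].
by case: (leb y y' Gy Gy' ymu) => -[ky ky']; rewrite ?(g0 _ ky, g0 _ ky') ?(g1 _ ky, g1 _ ky') ?(g2 _ ky, g2 _ ky');
  [exact: H0|exact: H1|exact: H2].
Qed.

(** The cyclic form makes the invariance under 3-cycles evident. *)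
Let disc (x1 x2 x3 : C) : C := (x1 - x2) * (x2 - x3) * (x3 - x1).

Lemma unif_cont_disc p q K f1 f2 f3 : lip_bounded K p -> lip_bounded K q ->
  root_selection p q K f1 -> root_selection p q K f2 -> root_selection p q K f3 ->
  unif_cont K (fun y => disc (f1 y) (f2 y) (f3 y)).
Proof.
move=> [a [a0 pa _]] [b [b0 qb _]].
pose r := 1 + 5 * (a + b).
have bnd f y : root_selection p q K f -> K y -> normc (f y) <= r.
  move=> [_ rf] Ky; apply: (cubic_root_le (rf _ Ky)).
    by apply: le_trans (pa _ Ky) _; rewrite lerDl.
  by apply: le_trans (qb _ Ky) _; rewrite lerDr.
have bndB f g y : root_selection p q K f -> root_selection p q K g -> K y ->
    normc (f y - g y) <= r + r.
  by move=> sf sg Ky; apply: le_trans (normcB _ _) _; apply: lerD; exact: bnd.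
have r0 : 0 <= r by rewrite addr_ge0 // mulr_ge0 // addr_ge0.
move=> s1 s2 s3; have [u1 _] := s1; have [u2 _] := s2; have [u3 _] := s3.
apply: (@unif_contM _ _ _ _ _ ((r + r) * (r + r) + (r + r))).
- apply: (@unif_contM _ _ _ _ _ (r + r)); try exact: unif_contB.
    by move=> y Ky; exact: bndB.
  by move=> y Ky; exact: bndB.
- exact: unif_contB.
- move=> y Ky; rewrite (normcM (f1 y - f2 y)); apply: ler_wpDr; first by rewrite addr_ge0.
  by apply: ler_pM; rewrite ?normc_ge0 ?bndB.
move=> y Ky; apply: ler_wpDl; last exact: bndB.
by rewrite mulr_ge0 // addr_ge0.
Qed.

(* The three sheets over [K0] return, after continuation through [K1] and
   [K2], permuted. A permutation of three letters fixes a letter, which gives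
   a global root, or is a 3-cycle, which fixes the square root of the
   discriminant. *)
Lemma cubic_dichotomy p q K0 K1 K2 (G : set V) c01 c12 c20 (mu : R) :
  cubic_cover p q K0 -> cubic_cover p q K1 -> cubic_cover p q K2 ->
  (K0 `&` K1) c01 -> (K1 `&` K2) c12 -> (K2 `&` K0) c20 -> 0 < mu ->
  (forall y y', G y -> G y' -> `|y - y'| < mu ->
     [\/ K0 y /\ K0 y', K1 y /\ K1 y' | K2 y /\ K2 y']) ->
  exists g, unif_cont G g /\
    ((forall y, G y -> cubic_root (p y) (q y) (g y)) \/
     (forall y, G y -> g y ^+ 2 = 108 * (p y ^+ 3 - q y ^+ 2))).
Proof.
move=> C0 C1 C2 k01 k12 k20 mu0 leb.
have cov y : G y -> [\/ K0 y, K1 y | K2 y].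
  move=> Gy; case: (leb y y Gy Gy); rewrite ?subrr ?normr0 // => -[k _];
  [constructor 1|constructor 2|constructor 3]; done.
have dn0 K y : cubic_cover p q K -> K y -> p y ^+ 3 != q y ^+ 2.
  move=> [_ _ _ _ [c0 [c00 Hc]]] Ky; rewrite -subr_eq0 -normc_eq0.
  by rewrite gt_eqF // (lt_le_trans c00) // Hc.
have [x1 [x2 [x3 [r1 r2 r3 [x12 x23 x31 _]]]]] := cubic_distinct_roots (dn0 _ _ C0 k01.1).
have ext K c x : cubic_cover p q K -> K c -> cubic_root (p c) (q c) x ->
   exists f, root_selection p q K f /\ f c = x by exact: root_selection_exists.
(* The sheets [f] over [K0] continue to [g] over [K1] through [c01], and these to [h] over [K2]
   through [c12]. Comparing [h] with [f] at [c20] gives the monodromy. *)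
have [f1 [sf1 f1c]] := ext _ _ _ C0 k01.1 r1.
have [f2 [sf2 f2c]] := ext _ _ _ C0 k01.1 r2.
have [f3 [sf3 f3c]] := ext _ _ _ C0 k01.1 r3.
have [g1 [sg1 g1c]] := ext _ _ _ C1 k01.2 r1.
have [g2 [sg2 g2c]] := ext _ _ _ C1 k01.2 r2.
have [g3 [sg3 g3c]] := ext _ _ _ C1 k01.2 r3.
have [h1 [sh1 h1c]] := ext _ _ _ C2 k12.2 (sg1.2 _ k12.1).
have [h2 [sh2 h2c]] := ext _ _ _ C2 k12.2 (sg2.2 _ k12.1).
have [h3 [sh3 h3c]] := ext _ _ _ C2 k12.2 (sg3.2 _ k12.1).
(* Overlaps are convex, so agreement at one point spreads over the whole overlap. *)
have agree A B f g c : cubic_cover p q A -> cubic_cover p q B ->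
    root_selection p q A f -> root_selection p q B g -> (A `&` B) c -> f c = g c ->
    forall y, A y -> B y -> f y = g y.
  move=> CA CB sf sg ABc fg y Ay By.
  apply: (root_selection_unique (cubic_coverI CA CB) _ _ ABc fg) => //.
    by apply: root_selectionS sf => z [].
  by apply: root_selectionS sg => z [].
have neq K f g c y : cubic_cover p q K -> root_selection p q K f ->
    root_selection p q K g -> K c -> f c != g c -> K y -> f y != g y.
  move=> CK sf sg Kc fg Ky; apply: contraNneq fg => fgy.
  by rewrite (root_selection_unique CK sf sg Ky fgy Kc).
have fg1 := agree _ _ _ _ _ C0 C1 sf1 sg1 k01 (etrans f1c (esym g1c)).
have fg2 := agree _ _ _ _ _ C0 C1 sf2 sg2 k01 (etrans f2c (esym g2c)).
have fg3 := agree _ _ _ _ _ C0 C1 sf3 sg3 k01 (etrans f3c (esym g3c)).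
have gh1 := agree _ _ _ _ _ C1 C2 sg1 sh1 k12 (esym h1c).
have gh2 := agree _ _ _ _ _ C1 C2 sg2 sh2 k12 (esym h2c).
have gh3 := agree _ _ _ _ _ C1 C2 sg3 sh3 k12 (esym h3c).
have root f g h : root_selection p q K0 f -> root_selection p q K1 g -> root_selection p q K2 h ->
    (forall y, K0 y -> K1 y -> f y = g y) -> (forall y, K1 y -> K2 y -> g y = h y) ->
    h c20 = f c20 -> exists g, unif_cont G g /\
    ((forall y, G y -> cubic_root (p y) (q y) (g y)) \/
     (forall y, G y -> g y ^+ 2 = 108 * (p y ^+ 3 - q y ^+ 2))).
  move=> sf sg sh fg gh hf; have hf' := agree _ _ _ _ _ C2 C0 sh sf k20 hf.
  have [u [uu u0 u1 u2]] := unif_cont_glue mu0 leb sf.1 sg.1 sh.1 fg gh hf'.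
  exists u; split=> //; left=> y /cov[k|k|k].
  - by rewrite u0 //; apply: sf.2.
  - by rewrite u1 //; apply: sg.2.
  - by rewrite u2 //; apply: sh.2.
have [e1|n1] := eqVneq (h1 c20) (f1 c20); first exact: (root f1 g1 h1).
have [e2|n2] := eqVneq (h2 c20) (f2 c20); first exact: (root f2 g2 h2).
have [e3|n3] := eqVneq (h3 c20) (f3 c20); first exact: (root f3 g3 h3).
have F12 y : K0 y -> f1 y != f2 y by apply: (neq _ _ _ c01); rewrite // ?k01.1 ?f1c ?f2c //; exact: k01.1.
have F23 y : K0 y -> f2 y != f3 y by apply: (neq _ _ _ c01); rewrite // ?f3c ?f2c //; exact: k01.1.
have F31 y : K0 y -> f3 y != f1 y by apply: (neq _ _ _ c01); rewrite // ?f1c ?f3c //; exact: k01.1.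
have G12 y : K1 y -> g1 y != g2 y by apply: (neq _ _ _ c01); rewrite // ?g1c ?g2c //; exact: k01.2.
have G23 y : K1 y -> g2 y != g3 y by apply: (neq _ _ _ c01); rewrite // ?g3c ?g2c //; exact: k01.2.
have G31 y : K1 y -> g3 y != g1 y by apply: (neq _ _ _ c01); rewrite // ?g1c ?g3c //; exact: k01.2.
have H12 y : K2 y -> h1 y != h2 y.
  by apply: (neq _ _ _ c12); rewrite // ?h1c ?h2c; [exact: k12.2|apply: G12; exact: k12.1].
have H23 y : K2 y -> h2 y != h3 y.
  by apply: (neq _ _ _ c12); rewrite // ?h3c ?h2c; [exact: k12.2|apply: G23; exact: k12.1].
have H31 y : K2 y -> h3 y != h1 y.
  by apply: (neq _ _ _ c12); rewrite // ?h3c ?h1c; [exact: k12.2|apply: G31; exact: k12.1].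
have among x : cubic_root (p c20) (q c20) x -> [\/ x = f1 c20, x = f2 c20 | x = f3 c20].
  have [z1 [z2 [z3 [_ _ _ [_ _ _ Hz]]]]] := cubic_distinct_roots (dn0 _ _ C0 k20.2).
  have := F12 _ k20.2; have := F23 _ k20.2; have := F31 _ k20.2.
  move=> a b c /Hz; have := Hz _ (sf1.2 _ k20.2); have := Hz _ (sf2.2 _ k20.2).
  have := Hz _ (sf3.2 _ k20.2).
  by case=> E3; case=> E2; case=> E1; case=> ->; move: a b c; rewrite ?E1 ?E2 ?E3 ?eqxx // => _ _ _;
    by [constructor 1|constructor 2|constructor 3].
(* With [n1], [n2], [n3] no sheet is fixed; as the sheets stay distinct, only the two 3-cycles
   survive the case analysis. *)
have hf : forall y, K2 y -> K0 y ->
    disc (h1 y) (h2 y) (h3 y) = disc (f1 y) (f2 y) (f3 y).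
  have same f g : root_selection p q K2 f -> root_selection p q K0 g ->
      f c20 = g c20 -> forall y, K2 y -> K0 y -> f y = g y.
    by move=> sf sg; apply: agree k20.
  have := H12 _ k20.1; have := H23 _ k20.1; have := H31 _ k20.1.
  case: (among _ (sh1.2 _ k20.1)) => [E|E|E]; first by rewrite E eqxx in n1.
    case: (among _ (sh3.2 _ k20.1)) => [E'|E'|E']; last by rewrite E' eqxx in n3.
      case: (among _ (sh2.2 _ k20.1)) => [E''|E''|E''].
      - by rewrite E' E'' eqxx.
      - by rewrite E'' eqxx in n2.
      move=> _ _ _ y k2 k0.
      rewrite (same _ _ sh1 sf2 E y) // (same _ _ sh2 sf3 E'' y) // (same _ _ sh3 sf1 E' y) //.
      by rewrite /disc; ring.
    by rewrite E E' eqxx.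
  case: (among _ (sh2.2 _ k20.1)) => [E'|E'|E'].
  - case: (among _ (sh3.2 _ k20.1)) => [E''|E''|E''].
    + by rewrite E' E'' eqxx.
    + move=> _ _ _ y k2 k0.
      rewrite (same _ _ sh1 sf3 E y) // (same _ _ sh2 sf1 E' y) // (same _ _ sh3 sf2 E'' y) //.
      by rewrite /disc; ring.
    by rewrite E'' eqxx in n3.
  - by rewrite E' eqxx in n2.
  by rewrite E E' eqxx.
have lipp K : cubic_cover p q K -> lip_bounded K p by case.
have lipq K : cubic_cover p q K -> lip_bounded K q by case.
have dE a b c a' b' c' : a = a' -> b = b' -> c = c' -> disc a b c = disc a' b' c' by move=> -> -> ->.
have [u [uu u0 u1 u2]] := unif_cont_glue mu0 leb
  (unif_cont_disc (lipp _ C0) (lipq _ C0) sf1 sf2 sf3)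
  (unif_cont_disc (lipp _ C1) (lipq _ C1) sg1 sg2 sg3)
  (unif_cont_disc (lipp _ C2) (lipq _ C2) sh1 sh2 sh3)
  (fun y k0 k1 => dE _ _ _ _ _ _ (fg1 y k0 k1) (fg2 y k0 k1) (fg3 y k0 k1))
  (fun y k0 k1 => dE _ _ _ _ _ _ (gh1 y k0 k1) (gh2 y k0 k1) (gh3 y k0 k1))
  hf.
exists u; split=> //; right=> y /cov[k|k|k].
- by rewrite u0 //; apply/esym/cubic_disc3; rewrite ?F12 ?F23 ?F31 //; [exact: sf1.2|exact: sf2.2|exact: sf3.2].
- by rewrite u1 //; apply/esym/cubic_disc3; rewrite ?G12 ?G23 ?G31 //; [exact: sg1.2|exact: sg2.2|exact: sg3.2].
by rewrite u2 //; apply/esym/cubic_disc3; rewrite ?H12 ?H23 ?H31 //; [exact: sh1.2|exact: sh2.2|exact: sh3.2].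
Qed.

End CubicCover.

(** * Roots of unit-circle loops *)

Section Circle.
Variable R : realType.
Local Notation C := R[i].

Definition cis (t : R) : C := cos t +i* sin t.

Lemma cisD a b : cis (a + b) = cis a * cis b.
Proof.
rewrite /cis cosD sinD; apply/eqP; rewrite eq_complex /=; apply/andP; split=> //.
by apply/eqP; ring.
Qed.

Lemma cis0 : cis 0 = 1.
Proof. by rewrite /cis cos0 sin0. Qed.

Lemma cisX a n : cis a ^+ n = cis (a * n%:R).
Proof.
elim: n => [|n IH]; first by rewrite mulr0 cis0.
by rewrite exprS IH -cisD -natr1 mulrDr mulr1 addrC.
Qed.

Lemma normc_cis a : normc (cis a) = 1.
Proof. by rewrite /normc /cis cos2Dsin2 sqrtr1. Qed.

Lemma derive_bound_lipschitz (f df : R -> R) :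
  (forall x : R, is_derive x 1 f (df x)) -> (forall x, `|df x| <= 1) ->
  forall a b, `|f a - f b| <= `|a - b|.
Proof.
move=> fd df1.
have H a b : a <= b -> `|f b - f a| <= `|b - a|.
  move=> ab; have [|c _ ->] := @MVT_segment R f df a b ab (fun x _ => fd x).
    apply: continuous_subspaceT => x; apply: differentiable_continuous.
    by apply/derivable1_diffP; case: (fd x).
  by rewrite normrM ler_piMl.
move=> a b; have [ab|/ltW ba] := leP b a; first exact: H.
by rewrite distrC (distrC a); exact: H.
Qed.

Lemma cis_lipschitz a b : normc (cis a - cis b) <= 2 * `|a - b|.
Proof.
apply: normc_le => /=.
  apply: (@derive_bound_lipschitz cos (fun x => - sin x)) => x.
  by rewrite normrN sin_max.
by apply: (@derive_bound_lipschitz sin cos) => x; exact: cos_max.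
Qed.

Lemma finite_separated (rs : seq C) : exists s : R, 0 < s /\
  forall x y, x \in rs -> y \in rs -> normc (x - y) < s -> x = y.
Proof.
have one (a : C) (ts : seq C) : exists s : R, 0 < s /\
    forall y, y \in ts -> normc (a - y) < s -> a = y.
  elim: ts => [|t ts [s [s0 H]]]; first by exists 1.
  exists (Num.min s (if a == t then 1 else normc (a - t))); split.
    rewrite lt_min s0 /=; case: (eqVneq a t) => // at_.
    by rewrite lt_def normc_eq0 subr_eq0 at_ normc_ge0.
  move=> y; rewrite inE lt_min => /orP[/eqP ->|/H h] /andP[ys]; last by rewrite h.
  by case: eqVneq => // _; rewrite ltxx.
elim: rs => [|a rs [s [s0 H]]]; first by exists 1.
have [s' [s'0 H']] := one a rs.
exists (Num.min s s'); split; first by rewrite lt_min s0.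
move=> x y; rewrite !inE lt_min => /orP[/eqP ->|xrs] /orP[/eqP ->|yrs] // /andP[xs xs'].
- exact: H'.
- by rewrite normcC in xs'; apply/esym/H'.
exact: H.
Qed.

Lemma power_separated m (A : C) : (0 < m)%N -> exists s : R, 0 < s /\
  forall x y, x ^+ m = A -> y ^+ m = A -> normc (x - y) < s -> x = y.
Proof.
move=> m0; have [rs rsE] := closed_field_poly_normal ('X^m - A%:P : {poly C}).
have [s [s0 H]] := finite_separated rs; exists s; split=> // x y xA yA.
have mem z : z ^+ m = A -> z \in rs.
  move=> zA; have : root ('X^m - A%:P) z by rewrite rootE hornerD hornerN hornerXn hornerC zA subrr.
  by rewrite rsE rootZ ?root_prod_XsubC // lead_coef_eq0 -size_poly_eq0 size_XnsubC.
by apply: H; exact: mem.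
Qed.

(** Dividing [F] by [cis (k * t / m)] leaves a continuous [m]-th root of the constant [A], which is
    constant because such roots are separated. Periodicity of [F] then forces the divisor to be
    periodic. *)
Lemma no_circle_root (F : R^o -> C) m (A : C) (k : R) : (0 < m)%N -> A != 0 ->
  unif_cont setT F -> (forall t, F t ^+ m = A * cis (k * t)) ->
  F (2 * pi) = F 0 -> cis (- (k * (2 * pi) / m%:R)) = 1.
Proof.
move=> m0 A0 uF Fm Fper.
have mR : m%:R != 0 :> R by rewrite pnatr_eq0 -lt0n.
pose c := k / m%:R.
pose kap (t : R^o) : C := F t * cis (- (c * t)).
have kapm t : kap t ^+ m = A.
  rewrite exprMn Fm cisX -mulrA -cisD.
  have -> : k * t + - (c * t) * m%:R = 0 by rewrite /c; field.
  by rewrite cis0 mulr1.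
have Fbnd t : normc (F t) <= 1 + normc A.
  have [h|h] := leP (normc (F t)) 1; first by have := normc_ge0 A; lra.
  have : normc (F t) ^+ m = normc A by rewrite -normcX Fm normcM normc_cis mulr1.
  have : normc (F t) <= normc (F t) ^+ m by apply: ler_eXnr => //; exact: ltW.
  lra.
have ucis : unif_cont (setT : set R^o) (fun t => cis (- (c * t))).
  move=> e e0; have c1 : 0 < 2 * `|c| + 1 by rewrite ltr_wpDl // mulr_ge0.
  exists (e / (2 * `|c| + 1)); split; first by rewrite divr_gt0.
  move=> t t' _ _; rewrite ltr_pdivlMr // => h; apply: le_lt_trans (cis_lipschitz _ _) _.
  have -> : - (c * t) - - (c * t') = c * (t' - t) by ring.
  rewrite normrM distrC; apply: le_lt_trans h.
  have := normr_ge0 (t - t'); have := normr_ge0 c; nra.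
have ukap : unif_cont setT kap.
  apply: (unif_contM (B := 1 + normc A) uF ucis) => t _; first exact: Fbnd.
  by rewrite normc_cis lerDl normc_ge0.
have [s [s0 Hs]] := power_separated A m0.
have [d [d0 Hd]] := ukap _ s0.
have : kap (2 * pi) = kap 0.
  apply: (@locally_constant R R^o setT (fun t => kap t = kap 0) d 0) => //.
  move=> t t' _ _ tt' <-; apply: Hs => //.
  by apply: Hd => //; rewrite distrC.
rewrite /kap Fper mulr0 oppr0 => /mulfI.
have F0 : F 0 != 0.
  apply: contraNneq A0 => F0; have := Fm 0.
  by rewrite F0 expr0n -[m == 0%N]negbK -lt0n m0 mulr0 cis0 mulr1 => <-.
move/(_ F0); rewrite cis0 => <-; congr cis; rewrite /c; ring.
Qed.

Lemma cis_thirdpi : cis (- (1 * (2 * pi) / 3%:R)) != 1.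
Proof.
have pi0 := pi_gt0 R.
apply/negP => /eqP [+ _]; rewrite cosN -[RHS](cos0 R) => h.
have : 1 * (2 * pi) / 3 = 0 :> R.
  by apply: (cos_inj _ _ h); rewrite in_itv /= ?lexx; lra.
lra.
Qed.

Lemma cis_3pi : cis (- (3 * (2 * pi) / 2%:R)) != 1.
Proof.
have -> : - (3 * (2 * pi) / 2%:R) = - (pi + pi *+ 2) :> R by rewrite -mulr_natl; field.
apply/negP => /eqP [+ _]; rewrite cosN cosD2pi cospi; lra.
Qed.

End Circle.

(** * The cone is not flat of dimension 2 at its vertex *)

Section NotFlat.
Variable R : realType.
Local Notation C := R[i].
Local Notation M := (@trefoil_cone R).
Local Notation i42 := (Ordinal (isT : (2 < 4)%N)).
Local Notation i43 := (Ordinal (isT : (3 < 4)%N)).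

Definition cusp_p (x : 'rV[R]_4) : C := wC x * (normc (wC x))%:C.
Definition cusp_q (x : 'rV[R]_4) : C := zC x * ((normc (zC x)) ^+ 2)%:C.

(** The pairs [(a, b)] used are [(1, 0)], [(-1, 1)] and [(0, -1)]. They sum to zero, so the three
    half-spaces surround the plane on which the last two coordinates vanish. *)
Definition slab (eps eta a b : R) : set 'rV[R]_4 :=
  [set y : 'rV[R]_4 | `|y| <= eps /\ eta <= a * y 0 i42 + b * y 0 i43].

Definition torus_loop (a b t : R) : 'rV[R]_4 := of_zwC (a%:C * cis t) (b%:C * cis t).

Lemma slab_convex eps eta a b : seg_convex (slab eps eta a b).
Proof.
move=> x y t [xe xl] [ye yl] /andP[t0 t1]; split.
  have -> : x + t *: (y - x) = (1 - t) *: x + t *: y.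
    by apply/rowP => i; rewrite !mxE; ring.
  apply: le_trans (ler_normD _ _) _; rewrite !normrZ !ger0_norm ?subr_ge0 //.
  by have := ler_wpM2l t0 ye; have := ler_wpM2l (_ : 0 <= 1 - t) xe; rewrite subr_ge0 => /(_ t1); lra.
rewrite !mxE; move: xl yl; set x2 := x 0 _; set x3 := x 0 _; set y2 := y 0 _; set y3 := y 0 _.
move=> xl yl; have := ler_wpM2l t0 yl; have := ler_wpM2l (_ : 0 <= 1 - t) xl.
by rewrite subr_ge0 => /(_ t1); lra.
Qed.

Lemma slab_compact eps eta a b : compact (slab eps eta a b).
Proof.
apply: bounded_closed_compact.
  by exists eps; split; [exact: num_real|move=> x rx y [ye _]; apply: le_trans ye _; exact: ltW].
apply: closedI.
  apply: (@closed_comp _ _ (fun y : 'rV[R]_4 => `|y|) [set x | x <= eps]).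
    by move=> x _; exact: norm_continuous.
  exact: closed_le.
apply: (@closed_comp _ _ (fun y : 'rV[R]_4 => a * y 0 i42 + b * y 0 i43) [set x | eta <= x]).
  move=> x _; apply: (@lipschitz_continuous R 'rV[R]_4 R^o _ (`|a| + `|b|)) => y y'.
  have -> : a * y 0 i42 + b * y 0 i43 - (a * y' 0 i42 + b * y' 0 i43) =
     a * (y - y') 0 i42 + b * (y - y') 0 i43 by rewrite !mxE; ring.
  rewrite mulrDl; apply: le_trans (ler_normD _ _) _.
  by rewrite !normrM; apply: lerD; rewrite ler_wpM2l // rV_coord_le.
exact: closed_ge.
Qed.

(** If [y2], [y3 - y2] and [- y3] were all below [2 * eta], both coordinates would be below
    [4 * eta] in absolute value. A move shorter than [eta / 2] costs each of these functionals less
    than [eta]. *)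
Lemma slab_lebesgue eps eta (y y' : 'rV[R]_4) : 0 < eta -> `|y| <= eps -> `|y'| <= eps ->
  4 * eta <= `|y 0 i42| \/ 4 * eta <= `|y 0 i43| -> `|y - y'| < eta / 2 ->
  [\/ slab eps eta 1 0 y /\ slab eps eta 1 0 y',
      slab eps eta (-1) 1 y /\ slab eps eta (-1) 1 y' |
      slab eps eta 0 (-1) y /\ slab eps eta 0 (-1) y'].
Proof.
move=> eta0 ye ye' yG yy.
have := le_lt_trans (rV_coord_le (y - y') i42) yy.
have := le_lt_trans (rV_coord_le (y - y') i43) yy.
rewrite !rV_subE /slab /=; move: (y 0 i42) (y 0 i43) (y' 0 i42) (y' 0 i43) yG => y2 y3 y2' y3' yG.
rewrite !ltr_norml => /andP[? ?] /andP[? ?]; clear yy.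
have [|h2] := leP (2 * eta) y2; first by constructor 1; split; split=> //; lra.
have [|h3] := leP (2 * eta) (- y3); first by constructor 3; split; split=> //; lra.
have [|h4] := leP (2 * eta) (y3 - y2); first by constructor 2; split; split=> //; lra.
have n2 : `|y2| < 4 * eta by rewrite ltr_norml; apply/andP; split; lra.
have n3 : `|y3| < 4 * eta by rewrite ltr_norml; apply/andP; split; lra.
by exfalso; case: yG => yG; [move: n2|move: n3]; rewrite ltNge yG.
Qed.

Lemma slabI_neq0 eps eta a b a' b' s t : 0 < eta -> 2 * eta <= eps ->
  `|s| <= 2 -> `|t| <= 2 -> 1 <= a * s + b * t -> 1 <= a' * s + b' * t ->
  exists c, (slab eps eta a b `&` slab eps eta a' b') c.
Proof.
move=> eta0 eta2 s2 t2 h h'; exists (row_seq 4 [:: 0; 0; eta * s; eta * t]).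
have le x : `|x| <= 2 -> `|eta * x| <= eps.
  move=> x2; apply: le_trans eta2; rewrite normrM gtr0_norm // mulrC.
  by rewrite ler_wpM2r // ltW.
have pe : `|row_seq 4 [:: 0; 0; eta * s; eta * t]| <= eps.
  apply: rV_norm_le; first by apply: le_trans eta2; rewrite mulr_ge0 // ltW.
  by move=> -[[|[|[|[|//]]]] ?]; rewrite !mxE /= ?le // normr0 (le_trans _ eta2) // mulr_ge0 // ltW.
have scale u v : 1 <= u * s + v * t -> eta <= u * (eta * s) + v * (eta * t).
  move=> uv; have -> : u * (eta * s) + v * (eta * t) = eta * (u * s + v * t) by ring.
  by rewrite -[leLHS]mulr1 ler_pM2l.
by split; split=> //; rewrite !mxE /=; exact: scale.
Qed.

Lemma torus_loop_lipschitz a b d t t' : `|a| <= d -> `|b| <= d ->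
  `|torus_loop a b t - torus_loop a b t'| <= 2 * d * `|t - t'|.
Proof.
move=> ad bd; have d0 := le_trans (normr_ge0 a) ad.
have h := cis_lipschitz t t'; have hn := normr_ge0 (t - t').
apply: norm_zwC_le.
  rewrite zCB !zC_of -mulrBr (normcM a%:C) normc_real.
  have := ler_pM (normr_ge0 a) (normc_ge0 _) ad h; lra.
rewrite wCB !wC_of -mulrBr (normcM b%:C) normc_real.
have := ler_pM (normr_ge0 b) (normc_ge0 _) bd h; lra.
Qed.

Lemma torus_loop_le a b d t : `|a| <= d -> `|b| <= d -> `|torus_loop a b t| <= d.
Proof.
move=> ad bd; apply: norm_zwC_le.
  by rewrite zC_of (normcM a%:C) normc_real normc_cis mulr1.
by rewrite wC_of (normcM b%:C) normc_real normc_cis mulr1.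
Qed.

(** The two complex coordinates have equal moduli on the cone and moduli [a], [b] on the loop, and
    each is 2-Lipschitz. *)
Lemma torus_loop_dist a b t x : 0 <= a -> 0 <= b -> M x ->
  `|a - b| <= 4 * `|torus_loop a b t - x|.
Proof.
move=> a0 b0 Mx; have zw := trefoil_cone_norm Mx.
have h1 := zC_lipschitz (torus_loop a b t) x.
have h2 := wC_lipschitz (torus_loop a b t) x.
have {}h1 := le_trans (normc_distD _ _) h1.
have {}h2 := le_trans (normc_distD _ _) h2.
move: h1 h2; rewrite /torus_loop zC_of wC_of (normcM a%:C) (normcM b%:C) !normc_real.
rewrite !normc_cis !mulr1 zw (ger0_norm a0) (ger0_norm b0) !ler_norml.
by move=> /andP[? ?] /andP[? ?]; apply/andP; split; lra.
Qed.

Lemma trefoil_cone_not_locally_flat : ~ lipschitz_submanifold 2 M.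
Proof.
move=> /flat_chart/(_ (trefoil_cone0 R)) [phi [psi [r [L [eps [[r0 L0 eps0 phi0] psiL phiM phiL phipsi]]]]]].
have phi_le x : `|x| <= r -> `|phi x| <= L * `|x|.
  by move=> xr; have := phiL x 0 xr; rewrite phi0 !subr0 normr0; apply; exact: ltW.
(* The circles of radius [d] lie in the domain of the chart, and their images in the [eps]-ball. *)
pose d := Num.min r (eps / L).
have d0 : 0 < d by rewrite lt_min r0 divr_gt0.
have dr : d <= r by rewrite ge_min lexx.
have de : L * d <= eps by rewrite mulrC -ler_pdivlMr // ge_min lexx orbT.
(* The circles are at distance at least [d / 4] from the cone, so their images are at distance at
   least [d / (4 * L)], hence [4 * eta], from the plane. The bound [eps / 2] leaves room for points
   in the overlaps of the slabs. *)
pose eta := Num.min (d / (16 * L)) (eps / 2).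
have eta0 : 0 < eta by rewrite lt_min !divr_gt0 // mulr_gt0.
have eta1 : 16 * (L * eta) <= d.
  by rewrite mulrA mulrC -ler_pdivlMr ?mulr_gt0 // ge_min lexx.
have eta2 : 2 * eta <= eps by rewrite mulrC -ler_pdivlMr // ge_min lexx orbT.
pose p y := cusp_p (psi y); pose q y := cusp_q (psi y).
pose B : set 'rV[R]_4 := [set y | `|y| <= eps].
have lipB i j : lip_bounded B (fun y => coordC i j (psi y)).
  exists (2 * (r + L)); split.
  - by rewrite mulr_ge0 // addr_ge0 // ltW.
  - move=> y /phipsi[yr _]; apply: le_trans (coordC_le _ _ _) _.
    by rewrite ler_pM2l // (le_trans yr) // lerDl ltW.
  move=> y y' By By'; apply: le_trans (coordC_lipschitz _ _ _ _) _.
  rewrite -mulrA ler_pM2l //; apply: le_trans (psiL _ _) _.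
  by rewrite ler_wpM2r // lerDr ltW.
have lipp : lip_bounded B p.
  by apply: lip_boundedM; [exact: lipB|apply: lip_bounded_norm; exact: lipB].
have lipq : lip_bounded B q.
  have -> : q = fun y => zC (psi y) * ((normc (zC (psi y)))%:C * (normc (zC (psi y)))%:C).
    by apply/funext => y; rewrite /q /cusp_q expr2 rmorphM.
  apply: lip_boundedM; first exact: lipB.
  by apply: lip_boundedM; apply: lip_bounded_norm; exact: lipB.
have slabB a b : slab eps eta a b `<=` B by move=> y [].
have cover a b : cubic_cover p q (slab eps eta a b).
  split.
  - exact: slab_convex.
  - exists (eps + eps) => y y' [ye _] [ye' _].
    by apply: le_trans (ler_normB _ _) _; exact: lerD.
  - exact: lip_boundedS (slabB a b) lipp.
  - exact: lip_boundedS (slabB a b) lipq.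
  have pq y : slab eps eta a b y -> normc (p y ^+ 3 - q y ^+ 2) != 0.
    move=> [ye yl]; rewrite normc_eq0 subr_eq0; apply/negP => /eqP /trefoil_coneP My.
    have [yr yE] := phipsi y ye.
    have [_ /proj1/(_ My) y0] := phiM _ yr; rewrite yE in y0.
    by move: yl; rewrite !y0 // !mulr0 addr0 leNgt eta0.
  have [b0 [b00 _ Hb]] : lip_bounded (slab eps eta a b) (fun y => p y ^+ 3 - q y ^+ 2).
    apply: lip_boundedS (slabB a b) _; apply: lip_boundedB.
      under eq_fun do rewrite exprS expr2.
      by do 2 apply: lip_boundedM => //.
    under eq_fun do rewrite expr2.
    exact: lip_boundedM.
  have [E|[y0 Ky0]] : slab eps eta a b = set0 \/ slab eps eta a b !=set0.
    by have [E|/set0P] := eqVneq (slab eps eta a b) set0; [left|right].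
    by exists 1; split=> // y; rewrite E.
  (* The modulus of the discriminant is Lipschitz on the slab only; its extension is continuous
     everywhere, as [compact_gap] requires. *)
  have [G [GE GL]] := @mcshane R _ (slab eps eta a b) (fun y => normc (p y ^+ 3 - q y ^+ 2))
    _ id b0 b00 (ex_intro _ y0 Ky0) (fun x x' Kx Kx' => le_trans (normc_distD _ _) (Hb x x' Kx Kx')).
  have [c0 [c00 Hc]] := @compact_gap R _ R^o (slab eps eta a b) G 0 (@slab_compact eps eta a b)
    (@lipschitz_continuous R _ R^o G b0 GL) (fun x Kx => ltac:(by rewrite GE ?pq)).
  exists c0; split=> // y Ky; have := Hc y Ky.
  by rewrite subr0 GE // ger0_norm ?normc_ge0.
pose G : set 'rV[R]_4 := [set y : 'rV[R]_4 | `|y| <= eps /\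
  (4 * eta <= `|y 0 i42| \/ 4 * eta <= `|y 0 i43|)].
have leb y y' : G y -> G y' -> `|y - y'| < eta / 2 ->
    [\/ slab eps eta 1 0 y /\ slab eps eta 1 0 y',
        slab eps eta (-1) 1 y /\ slab eps eta (-1) 1 y' |
        slab eps eta 0 (-1) y /\ slab eps eta 0 (-1) y'].
  by move=> [ye yG] [ye' _]; exact: slab_lebesgue.
have [c01 k01] : exists c, (slab eps eta 1 0 `&` slab eps eta (-1) 1) c.
  by apply: (@slabI_neq0 _ _ _ _ _ _ 1 2) => //; rewrite ?ler_norml; lra.
have [c12 k12] : exists c, (slab eps eta (-1) 1 `&` slab eps eta 0 (-1)) c.
  by apply: (@slabI_neq0 _ _ _ _ _ _ (-2) (-1)) => //; rewrite ?ler_norml; lra.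
have [c20 k20] : exists c, (slab eps eta 0 (-1) `&` slab eps eta 1 0) c.
  by apply: (@slabI_neq0 _ _ _ _ _ _ 1 (-1)) => //; rewrite ?ler_norml; lra.
have [g [ug Hg]] := cubic_dichotomy (cover 1 0) (cover (-1) 1) (cover 0 (-1))
  k01 k12 k20 (divr_gt0 eta0 (ltr0n R 2)) leb.
pose gam a b t := phi (torus_loop a b t).
have par a b : 0 <= a <= d -> 0 <= b <= d -> `|a - b| = d ->
    [/\ forall t, G (gam a b t), forall t, psi (gam a b t) = torus_loop a b t,
        unif_cont (setT : set R^o) (fun t => g (gam a b t)) &
        gam a b (2 * pi) = gam a b 0].
  move=> /andP[a0 ad] /andP[b0 bd] abd.
  have na : `|a| <= d by rewrite ger0_norm.
  have nb : `|b| <= d by rewrite ger0_norm.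
  have lr t : `|torus_loop a b t| <= r by apply: le_trans dr; exact: torus_loop_le.
  have psigam t : psi (gam a b t) = torus_loop a b t by case: (phiM _ (lr t)).
  have Ggam t : G (gam a b t).
    have ye : `|gam a b t| <= eps.
      apply: le_trans (phi_le _ (lr t)) _; apply: le_trans de.
      by rewrite ler_pM2l // torus_loop_le.
    split=> //; set y := gam a b t.
    (* The projection of [y] to the plane; [psi] sends it into the cone, which the loop avoids. *)
    pose y0 : 'rV[R]_4 := \row_i (if (i < 2)%N then y 0 i else 0).
    have y0e : `|y0| <= eps.
      apply: le_trans ye; apply: rV_norm_le => // i; rewrite mxE.
      by case: ifP; rewrite ?normr0 // rV_coord_le.
    have [y0r y0E] := phipsi _ y0e.
    have My0 : M (psi y0).
      by apply/(phiM _ y0r).2 => i i2; rewrite y0E mxE ltnNge i2.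
    have := torus_loop_dist t a0 b0 My0; rewrite abd -psigam -/y => h.
    pose m := Num.max `|y 0 i42| `|y 0 i43|.
    have ym : `|y - y0| <= m.
      apply: rV_norm_le; first by rewrite le_max normr_ge0.
      move=> -[[|[|[|[|//]]]] i4]; rewrite rV_subE [y0 _ _]mxE /= ?subrr ?normr0 ?subr0 le_max ?normr_ge0 //.
        by rewrite (_ : Ordinal i4 = i42) ?lexx //; exact/val_inj.
      by rewrite (_ : Ordinal i4 = i43) ?lexx ?orbT //; exact/val_inj.
    have : 4 * eta <= m.
      have := le_trans (psiL y y0) (ler_wpM2l (ltW L0) ym).
      rewrite -(ler_pM2l L0); lra.
    by rewrite le_max => /orP[]; [left|right].
  split=> //.
  - move=> e e0; have [d' [d'0 Hd']] := ug _ e0.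
    have A0 : 0 < L * (2 * d) by rewrite !mulr_gt0.
    exists (d' / (L * (2 * d))); split; first by rewrite divr_gt0.
    move=> t t' _ _; rewrite ltr_pdivlMr // => tt; apply: Hd' => //.
    apply: le_lt_trans tt; apply: le_trans (phiL _ _ (lr t) (lr t')) _.
    by rewrite [leRHS]mulrC -mulrA ler_pM2l // torus_loop_lipschitz.
  congr phi; rewrite /torus_loop; suff -> : cis (2 * pi) = cis (0 : R) by [].
  by rewrite /cis mulr_natl cos2pi sin2pi cos0 sin0.
have d_itv : 0 <= d <= d by rewrite (ltW d0) /=.
have z_itv : 0 <= (0 : R) <= d by rewrite (ltW d0) andbT.
have dC0 : d%:C != 0 by rewrite realc_eq0 gt_eqF.
have norm_d t : normc (d%:C * cis t) = d by rewrite normcM normc_real normc_cis mulr1 gtr0_norm.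
case: Hg => Hg.
  have [|Gg psig uF per] := par d 0 d_itv z_itv; first by rewrite subr0 gtr0_norm.
  have A0 : - (2 * d%:C ^+ 3) != 0 by rewrite oppr_eq0 mulf_neq0 ?pnatr_eq0 // expf_neq0.
  apply/negP: (cis_thirdpi R); rewrite negbK; apply/eqP.
  apply: (no_circle_root _ A0 uF _ (congr1 g per)) => // t.
  have := Hg _ (Gg t); rewrite /cubic_root /p /q psig /cusp_p /cusp_q zC_of wC_of.
  rewrite norm_d rmorphXn !mul0r mulr0 mul0r subr0 mul1r => /eqP.
  by rewrite addr_eq0 => /eqP ->; ring.
have [|Gg psig uF per] := par 0 d z_itv d_itv; first by rewrite sub0r normrN gtr0_norm.
have A0 : 108 * (d%:C ^+ 2) ^+ 3 != 0 by rewrite mulf_neq0 ?pnatr_eq0 // !expf_neq0.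
apply/negP: (cis_3pi R); rewrite negbK; apply/eqP.
apply: (no_circle_root _ A0 uF _ (congr1 g per)) => // t.
rewrite (Hg _ (Gg t)) /p /q psig /cusp_p /cusp_q zC_of wC_of norm_d !mul0r.
by rewrite mulrC -[3 * t]mulrC -cisX; ring.
Qed.

End NotFlat.

Theorem proposition1p7 (R : realType) :
  exists (k N : nat) (M : set 'rV[R]_N),
    [/\ (0 < k)%N, (0 < N)%N,
        parametric_lipschitz_manifold k M &
        forall l : nat, ~ lipschitz_submanifold l M].
Proof.
exists 2, 4, (@trefoil_cone R); split=> //; first exact: trefoil_cone_parametric.
move=> l; case: (ltngtP l 2) => [l2|l2|->].
- exact: trefoil_cone_not_thin.
- exact: trefoil_cone_not_thick.
exact: trefoil_cone_not_locally_flat.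
Qed.
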